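(* Every $\omega$-congruence-finite lattice $K$ has an $\omega$-congruence-finite, relatively complemented congruence-preserving extension $L$. Furthermore, if $K$ has a zero, then $L$ can be taken to have the same zero.
   Context: For a lattice $L$, $\operatorname{Con} L$ denotes the lattice of all congruences of $L$. A lattice $L$ is congruence-finite if $\operatorname{Con} L$ is finite; it is $\omega$-congruence-finite if $L=\bigcup_{n<\omega}L_n$ for some increasing sequence $(L_n)_{n<\omega}$ of congruence-finite sublattices of $L$ (i.e. $L_n\subseteq L_{n+1}$ for all $n$). A lattice $L$ is an extension of a lattice $K$ if $K$ is a sublattice of $L$; it is a congruence-preserving extension of $K$ if, moreover, every congruence of $K$ has exactly one extension to $L$, i.e. for every congruence $\Theta$ of $K$ there is exactly one congruence of $L$ whose restriction to $K$ is $\Theta$. A lattice $L$ is relatively complemented if for all $a\leq b\leq c$ in $L$ there is $x\in L$ with $b\wedge x=a$ and $b\vee x=c$. The zero of a lattice is its least element. *)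

(* Defs.v *)
From mathcomp Require Import all_boot all_order.
From mathcomp Require Import boolp classical_sets functions cardinality.

Set Implicit Arguments.
Unset Strict Implicit.
Unset Printing Implicit Defensive.

Local Open Scope classical_set_scope.
Local Open Scope order_scope.

Definition sublattice d (L : latticeType d) (A : set L) : Prop :=
  forall x y, A x -> A y -> A (x `&` y) /\ A (x `|` y).

(* [congruence A r] is meant for a sublattice [A]. The inclusion in [A `*` A]
   makes [r] a relation on [A] rather than on the ambient lattice, so that
   distinct sets [r] are distinct congruences of [A]. *)
Record congruence d (L : latticeType d) (A : set L) (r : set (L * L)) : Prop :=
  Congruence {
    congr_sub : r `<=` A `*` A ;
    congr_refl : forall x, A x -> r (x, x) ;
    congr_sym : forall x y, r (x, y) -> r (y, x) ;
    congr_trans : forall x y z, r (x, y) -> r (y, z) -> r (x, z) ;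
    congr_meet : forall x1 y1 x2 y2,
      r (x1, y1) -> r (x2, y2) -> r (x1 `&` x2, y1 `&` y2) ;
    congr_join : forall x1 y1 x2 y2,
      r (x1, y1) -> r (x2, y2) -> r (x1 `|` x2, y1 `|` y2) }.

Definition Con d (L : latticeType d) (A : set L) : set (set (L * L)) :=
  [set r | congruence A r].

Definition congruence_finite d (L : latticeType d) (A : set L) : Prop :=
  finite_set (Con A).

Definition omega_congruence_finite d (L : latticeType d) : Prop :=
  exists F : nat -> set L,
    [/\ forall n, sublattice (F n),
        forall n, congruence_finite (F n),
        forall n, F n `<=` F n.+1
      & \bigcup_n F n = [set: L]].

Definition relatively_complemented d (L : latticeType d) : Prop :=
  forall a b c : L, a <= b -> b <= c ->
    exists x : L, b `&` x = a /\ b `|` x = c.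

(* Extensions are lattice embeddings [f : K -> L]; restricting a congruence of
   [L] to (the image of) [K] is pulling it back along [f]. *)
Definition restriction d (K : latticeType d) d' (L : latticeType d')
    (f : K -> L) (r : set (L * L)) : set (K * K) :=
  [set p | r (f p.1, f p.2)].

Definition congruence_preserving_extension d (K : latticeType d)
    d' (L : latticeType d') (f : {lmorphism K -> L}) : Prop :=
  injective f /\
  forall r, Con [set: K] r ->
    exists! s, Con [set: L] s /\ restriction f s = r.

Definition is_zero d (L : latticeType d) (z : L) : Prop := lbound [set: L] z.

(* Main.v *)
Require Import Defs.
From HB Require Import structures.
From mathcomp Require Import all_boot all_order.
From mathcomp Require Import boolp classical_sets functions cardinality.

(** Let [K] be the union of the increasing sequence of congruence-finite
    sublattices [K_n].  Starting from [L_0 = K_0], one builds lattices [L_n],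
    congruence-preserving embeddings [K_n -> L_n] and homomorphisms
    [L_n -> L_(n+1)] over the inclusions [K_n -> K_(n+1)], in such a way that
    whenever [a <= b <= c] in [L_n], a relative complement of [b] in the
    interval from [a] to [c] exists in [L_(n+1)].  The direct limit [L] of the
    [L_n] is then relatively complemented.  A congruence of [K] amounts to a
    compatible sequence of congruences of the [K_n], hence to a compatible
    sequence of congruences of the [L_n], hence to a congruence of [L]
    ([limit_congr]).  The images of the [L_n] in [L] are congruence-finite since
    [Con L_n] is in bijection with [Con K_n].

    The passage from [n] to [n+1] is an amalgamation problem ([amalgam_step]):
    given [f : C -> A] with [Con A] finite and a congruence-preserving
    [g : C -> B], find [G] with [A -> G] congruence-preserving and [B -> G]
    agreeing with it on [C].  The lattice [Con A] is finite and distributive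
    ([congr_distr]), so its elements correspond to the up-sets of the ordered
    set [P] of prime congruences of [A] ([prime_separates], [prime_bigcap]).
    For each [m] in [P], the trace of [m] on [C] extends to a congruence [m'] of
    [B].  The lattices [A/m] and [B/m'] embed in an amalgam over their common
    sublattice, the amalgam in a lattice where relative complements have been
    adjoined ([compl_emb_compl]), and the latter in a simple bounded lattice
    [T_m] whose top lies outside the image ([spiked_simple]).

    It remains to combine the [T_m].  The product of simple lattices has the
    Boolean lattice of all subsets of [P] as its congruence lattice, whereas
    only the down-sets of [P] should be left.  This is achieved by keeping those
    families [x] in the product such that [x_q = top] implies [x_p = top] for
    all [p <= q]: they form a lattice ([glued]), and in it a congruence that
    moves the coordinate [q] also moves the coordinates [p <= q], because the
    top of [T_q] is the join of two smaller elements ([glued_congr]).  As the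
    maps from [A] and [B] to the [T_m] avoid the tops, they combine into
    homomorphisms to [glued] ([glued_lift]).

    A zero of [K] belongs to all [K_n] once finitely many of them are dropped,
    and it stays least along the construction because it is made to belong to
    every closed set of the amalgams. *)

Set Implicit Arguments.
Unset Strict Implicit.
Unset Printing Implicit Defensive.

Import Order.TTheory.

Local Open Scope classical_set_scope.
Local Open Scope order_scope.

(** * Lattices presented by an order relation *)

(** Infima and suprema are only required to exist: the operations are then
    obtained by choice, so that each construction below amounts to an order and
    two existence proofs. *)
Record lat_data := LatData {
  carrier :> Type;
  cle : carrier -> carrier -> Prop;
  cle_refl : forall x, cle x x;
  cle_anti : forall x y, cle x y -> cle y x -> x = y;
  cle_trans : forall x y z, cle x y -> cle y z -> cle x z;
  cinf_ex : forall x y, exists m, forall z, cle z m <-> cle z x /\ cle z y;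
  csup_ex : forall x y, exists j, forall z, cle j z <-> cle x z /\ cle y z }.

Fact cdisp : Order.disp_t. Proof. exact: Order.Disp tt tt. Qed.

Definition lat_of (D : lat_data) : Type := carrier D.

Section LatOf.
Variable D : lat_data.

HB.instance Definition _ := gen_eqMixin (lat_of D).
HB.instance Definition _ := gen_choiceMixin (lat_of D).

Let le (x y : lat_of D) : bool := `[< cle x y >].

Let le_refl : reflexive le. Proof. by move=> x; apply/asboolP/cle_refl. Qed.

Let le_anti : antisymmetric le.
Proof. by move=> x y /andP[/asboolP ? /asboolP ?]; exact: cle_anti. Qed.

Let le_trans : transitive le.
Proof. by move=> y x z /asboolP ? /asboolP ?; apply/asboolP/(cle_trans (y := y)). Qed.

HB.instance Definition _ :=
  Order.Le_isPOrder.Build cdisp (lat_of D) le_refl le_anti le_trans.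

Lemma latP (x y : lat_of D) : (x <= y) <-> cle x y.
Proof. by split=> [/asboolP|?] //; apply/asboolP. Qed.

Let inf (x y : lat_of D) : lat_of D := proj1_sig (cid (cinf_ex x y)).
Let sup (x y : lat_of D) : lat_of D := proj1_sig (cid (csup_ex x y)).

Let infP (x y z : lat_of D) : (x <= inf y z) = (x <= y) && (x <= z).
Proof.
rewrite /inf; case: cid => m /= mP; apply/idP/andP.
  by move=> /latP/mP[? ?]; split; apply/latP.
by move=> [/latP ? /latP ?]; apply/latP/mP.
Qed.

Let supP (x y z : lat_of D) : (sup x y <= z) = (x <= z) && (y <= z).
Proof.
rewrite /sup; case: cid => m /= mP; apply/idP/andP.
  by move=> /latP/mP[? ?]; split; apply/latP.
by move=> [/latP ? /latP ?]; apply/latP/mP.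
Qed.

HB.instance Definition _ :=
  Order.POrder_isMeetSemilattice.Build cdisp (lat_of D) infP.
HB.instance Definition _ :=
  Order.POrder_isJoinSemilattice.Build cdisp (lat_of D) supP.

End LatOf.

Lemma meet_char d (L : latticeType d) (x y m : L) :
  m <= x -> m <= y -> (forall z, z <= x -> z <= y -> z <= m) -> x `&` y = m.
Proof.
move=> mx my mP; apply/le_anti; rewrite lexI mx my !andbT.
by apply: mP; rewrite ?leIl ?leIr.
Qed.

Lemma join_char d (L : latticeType d) (x y j : L) :
  x <= j -> y <= j -> (forall z, x <= z -> y <= z -> j <= z) -> x `|` y = j.
Proof.
move=> xj yj jP; apply/le_anti; rewrite leUx xj yj /=.
by apply: jP; rewrite ?leUl ?leUr.
Qed.

(** * Homomorphisms and congruences *)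

Definition lhom d (K : latticeType d) d' (L : latticeType d') (f : K -> L) :=
  (forall x y, f (x `&` y) = f x `&` f y) /\
  (forall x y, f (x `|` y) = f x `|` f y).

Lemma lhom_le d (K : latticeType d) d' (L : latticeType d') (f : K -> L) :
  lhom f -> {homo f : x y / x <= y}.
Proof. by move=> [fI _] x y /meet_idPl xy; apply/meet_idPl; rewrite -fI xy. Qed.

Lemma lhom_comp d (K : latticeType d) d' (L : latticeType d')
    d'' (M : latticeType d'') (f : K -> L) (g : L -> M) :
  lhom f -> lhom g -> lhom (g \o f).
Proof. by move=> [fI fU] [gI gU]; split=> x y /=; rewrite ?fI ?fU ?gI ?gU. Qed.

Lemma congr_preimage d (K : latticeType d) d' (L : latticeType d') (f : K -> L) r :
  lhom f -> congruence setT r -> congruence setT (restriction f r).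
Proof.
move=> [fI fU] [_ rr rs rt rI rU]; split=> //.
- by move=> x _; exact: rr.
- by move=> x y; exact: rs.
- by move=> x y z; exact: rt.
- by move=> x1 y1 x2 y2; rewrite /restriction /= !fI; exact: rI.
- by move=> x1 y1 x2 y2; rewrite /restriction /= !fU; exact: rU.
Qed.

Section Congruences.
Variables (d : Order.disp_t) (L : latticeType d).
Implicit Types (r s m : set (L * L)) (x y z : L).

Lemma congr_meetr r x y z : congruence setT r -> r (x, y) -> r (x `&` z, y `&` z).
Proof. by move=> cr rxy; apply: (congr_meet cr) rxy (congr_refl cr _). Qed.

Lemma congr_joinr r x y z : congruence setT r -> r (x, y) -> r (x `|` z, y `|` z).
Proof. by move=> cr rxy; apply: (congr_join cr) rxy (congr_refl cr _). Qed.

Lemma congr_meetl r x y z : congruence setT r -> r (x, y) -> r (z `&` x, z `&` y).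
Proof. by move=> cr rxy; rewrite ![z `&` _]meetC; exact: congr_meetr. Qed.

Lemma congr_joinl r x y z : congruence setT r -> r (x, y) -> r (z `|` x, z `|` y).
Proof. by move=> cr rxy; rewrite ![z `|` _]joinC; exact: congr_joinr. Qed.

(** The order of the quotient lattice, read on representatives; it spares
    forming quotients. *)
Definition le_mod r x y := r (x `&` y, x).

Section LeMod.
Variables (r : set (L * L)) (cr : congruence setT r).

Lemma le_modW x y : x <= y -> le_mod r x y.
Proof. by move=> /meet_idPl xy; rewrite /le_mod xy; exact: (congr_refl cr). Qed.

Lemma le_mod_trans x y z : le_mod r x y -> le_mod r y z -> le_mod r x z.
Proof.
move=> xy yz; apply: (congr_trans cr (y := x `&` y)) => //.
apply: (congr_trans cr (y := x `&` (y `&` z))).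
  rewrite meetA; apply: (congr_meetr _ cr).
  exact: (congr_sym cr).
exact: congr_meetl.
Qed.

Lemma le_mod_join x y z : le_mod r x z -> le_mod r y z -> le_mod r (x `|` y) z.
Proof.
move=> xz yz; have U := congr_join cr xz yz.
apply: (congr_trans cr (y := (x `|` y) `&` z `|` ((x `&` z) `|` (y `&` z)))).
  have -> // : (x `|` y) `&` z `|` ((x `&` z) `|` (y `&` z)) = (x `|` y) `&` z.
    by apply/join_idPl; rewrite leUx !leI2 ?leUl ?leUr.
  exact: (congr_refl cr).
have /join_idPr {2}<- : (x `|` y) `&` z <= x `|` y by rewrite leIl.
exact: congr_joinl.
Qed.

Lemma le_mod_meet x y z : le_mod r x y -> le_mod r x z -> le_mod r x (y `&` z).
Proof.
move=> xy xz; apply: (congr_trans cr (y := x `&` z)) => //.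
by rewrite meetA; apply: congr_meetr.
Qed.

Lemma le_mod_anti x y : le_mod r x y -> le_mod r y x -> r (x, y).
Proof.
move=> xy yx; apply: (congr_trans cr (y := x `&` y)); first exact: (congr_sym cr).
by rewrite meetC.
Qed.

Lemma le_mod_congr x y : r (x, y) -> le_mod r x y.
Proof.
move=> xy; rewrite /le_mod -{2}(meetxx x).
by apply: (congr_meetl _ cr); exact: (congr_sym cr).
Qed.

End LeMod.

Lemma congr_bigcap (S : set (set (L * L))) :
  (forall r, S r -> congruence setT r) ->
  congruence setT [set p | forall r, S r -> r p].
Proof.
move=> SP; split=> //= [x _|x y xy|x y z xy yz|x1 y1 x2 y2 h1 h2|x1 y1 x2 y2 h1 h2] r Sr;
  have cr := SP r Sr.
- exact: (congr_refl cr).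
- by apply: (congr_sym cr); exact: xy.
- exact: (congr_trans cr (xy r Sr) (yz r Sr)).
- exact: (congr_meet cr (h1 r Sr) (h2 r Sr)).
- exact: (congr_join cr (h1 r Sr) (h2 r Sr)).
Qed.

Inductive path_of r x : L -> Prop :=
| path_nil : path_of r x x
| path_rcons y z : path_of r x y -> r (y, z) -> path_of r x z.

(** The congruence join, as the transitive closure of the union. *)
Definition congr_sup r s : set (L * L) :=
  [set p | path_of (r `|` s)%classic p.1 p.2].

Lemma path_trans r x y z : path_of r x y -> path_of r y z -> path_of r x z.
Proof. by move=> xy; elim=> // u v _ xu uv; exact: path_rcons xu uv. Qed.

Lemma path_map r s (h : L -> L) x y :
  (forall u v, r (u, v) -> s (h u, h v)) -> path_of r x y -> path_of s (h x) (h y).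
Proof.
move=> hP; elim=> [|u v _ IH uv]; first exact: path_nil.
exact: path_rcons IH (hP _ _ uv).
Qed.

Lemma congr_supP r s : congruence setT r -> congruence setT s ->
  congruence setT (congr_sup r s).
Proof.
move=> cr cs.
have one h : (forall u v, r (u, v) -> r (h u, h v)) ->
    (forall u v, s (u, v) -> s (h u, h v)) ->
    forall x y, congr_sup r s (x, y) -> congr_sup r s (h x, h y).
  move=> hr hs x y; apply: path_map => u v.
  by case=> ?; [left; exact: hr|right; exact: hs].
have sym x y : congr_sup r s (x, y) -> congr_sup r s (y, x).
  rewrite /congr_sup /=; elim=> [|u v _ IH uv]; first exact: path_nil.
  apply: path_trans IH; apply: path_rcons; first exact: path_nil.
  by case: uv => ?; [left; exact: (congr_sym cr)|right; exact: (congr_sym cs)].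
split=> //.
- by move=> x _; exact: path_nil.
- by move=> x y z; exact: path_trans.
- move=> x1 y1 x2 y2 h1 h2.
  apply: (@path_trans _ _ (y1 `&` x2)).
    by apply: (one (fun t => t `&` x2)) h1 => u v; exact: congr_meetr.
  by apply: (one (fun t => y1 `&` t)) h2 => u v; exact: congr_meetl.
- move=> x1 y1 x2 y2 h1 h2.
  apply: (@path_trans _ _ (y1 `|` x2)).
    by apply: (one (fun t => t `|` x2)) h1 => u v; exact: congr_joinr.
  by apply: (one (fun t => y1 `|` t)) h2 => u v; exact: congr_joinl.
Qed.

Definition median x y z := (x `&` y) `|` ((x `&` z) `|` (y `&` z)).

(** Lattices have a majority term, whence the congruence lattice is
    distributive: applying [median x y] to a path from [x] to [y] yields a path
    between the same points all of whose vertices are [t]-congruent to [x]. *)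
Lemma congr_distr t r s x y :
  congruence setT t -> congruence setT r -> congruence setT s ->
  t (x, y) -> congr_sup r s (x, y) -> congr_sup (t `&` r)%classic (t `&` s)%classic (x, y).
Proof.
move=> ct cr cs txy; rewrite /congr_sup /=.
have med q u v : congruence setT q -> q (u, v) -> q (median x y u, median x y v).
  move=> cq quv; apply: congr_joinl => //.
  by apply: (congr_join cq); apply: congr_meetl.
have medt u : t (x, median x y u).
  rewrite -{1}(_ : median x x u = x); last by rewrite /median meetxx joinxx meetKU.
  apply: (congr_join ct); first exact: congr_meetl.
  apply: (congr_join ct); first exact: (congr_refl ct).
  exact: congr_meetr.
have medx : median x y x = x.
  by rewrite /median meetxx [y `&` x]meetC joinA [_ `|` x]joinC !meetKU.
have medy : median x y y = y.
  by rewrite /median meetxx joinA joinxx meetUK.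
suff step u v : (r `|` s)%classic (u, v) ->
    ((t `&` r) `|` (t `&` s))%classic (median x y u, median x y v).
  by have := path_map step; move=> /(_ x y); rewrite medx medy; apply.
move=> uv.
have t_uv : t (median x y u, median x y v).
  by apply: (congr_trans ct (y := x)) => //; exact: (congr_sym ct).
by case: uv => ?; [left|right]; split=> //; exact: med.
Qed.

End Congruences.

(** * Prime congruences *)

Lemma finite_transfer X Y (S : set X) (T : set Y) (f : X -> Y) :
  finite_set T -> (forall x, S x -> T (f x)) ->
  (forall x y, S x -> S y -> f x = f y -> x = y) -> finite_set S.
Proof.
move=> fT ST fI; have fS : finite_set (f @` S).
  by apply: sub_finite_set fT => _ [x Sx <-]; exact: ST.
have e : (f @` S #= S)%card by apply: inj_card_eq => x y; rewrite !inE; exact: fI.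
by apply: (card_le_finite _ fS); rewrite (card_le_eqr e).
Qed.

Lemma finite_maximal U (S : set (set U)) : finite_set S ->
  forall X, S X -> exists Y, [/\ S Y, X `<=` Y & forall Z, S Z -> Y `<=` Z -> Z = Y].
Proof.
move=> /finite_seqP[s ->] {S}; elim: s => // a s IH.
have step X : X \in s -> exists Y, [/\ Y \in a :: s, X `<=` Y &
    forall Z, Z \in a :: s -> Y `<=` Z -> Z = Y].
  move=> /IH[W [Ws XW Wmax]]; case: (pselect (W `<=` a)) => [Wa|nWa].
    exists a; split; [by rewrite inE eqxx|exact: subset_trans Wa|].
    move=> Z; rewrite inE => /orP[/eqP //|Zs] aZ.
    have eZ := Wmax Z Zs (subset_trans Wa aZ).
    by apply/seteqP; split=> //; rewrite eZ.
  exists W; split=> //; first by rewrite inE Ws orbT.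
  move=> Z; rewrite inE => /orP[/eqP -> //|Zs]; exact: Wmax.
move=> X; rewrite /= inE => /orP[/eqP ->|]; last exact: step.
case: (pselect (exists2 Z, Z \in s & a `<=` Z)) => [[Z Zs aZ]|nZ].
  have [Y [Ys ZY Ymax]] := step Z Zs.
  by exists Y; split=> //; exact: subset_trans ZY.
exists a; split=> //; first by rewrite inE eqxx.
move=> Z; rewrite inE => /orP[/eqP //|Zs aZ].
by case: nZ; exists Z.
Qed.

Section Primes.
Variables (d : Order.disp_t) (A : latticeType d).
Implicit Types r s m : set (A * A).

(** The meet-prime elements of the congruence lattice. *)
Record prime_congr m : Prop := PrimeCongr {
  prime_congrP : congruence setT m;
  prime_proper : exists p, ~ m p;
  prime_meet : forall r s, congruence setT r -> congruence setT s ->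
    r `&` s `<=` m -> r `<=` m \/ s `<=` m }.

(** In a finite congruence lattice a congruence that is maximal among those
    avoiding a given pair is meet-irreducible, hence prime by distributivity. *)
Lemma prime_separates r x y :
  congruence_finite [set: A] -> congruence setT r -> ~ r (x, y) ->
  exists m, [/\ prime_congr m, r `<=` m & ~ m (x, y)].
Proof.
move=> fin cr rxy.
have fS : finite_set [set m | congruence setT m /\ ~ m (x, y)].
  by apply: sub_finite_set fin => m [].
have [m [[cm mxy] rm mmax]] := finite_maximal fS (conj cr rxy).
exists m; split=> //; split=> //; first by exists (x, y).
move=> a b ca cb abm; apply: contrapT => /not_orP[am bm].
have up c : congruence setT c -> ~ (c `<=` m) -> congr_sup m c (x, y).
  move=> cc cm'; apply: contrapT => nxy; apply: cm'.
  rewrite -(mmax (congr_sup m c)).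
  - move=> [u v] cuv; apply: path_rcons; first exact: path_nil.
    by right.
  - by split=> //; exact: congr_supP.
  - move=> [u v] cuv; apply: path_rcons; first exact: path_nil.
    by left.
have path_m s u v : s `<=` m -> path_of s u v -> m (u, v).
  move=> sm; elim=> [|w z _ IH wz]; first exact: (congr_refl cm).
  exact: (congr_trans cm IH (sm _ wz)).
have xy_mb := congr_distr (congr_supP cm ca) cm cb (up _ ca am) (up _ cb bm).
apply: mxy; apply: (path_m _ _ _ _ xy_mb).
move=> [u v] /= [[_ //]|[uv_ma uv_b]].
apply: (path_m _ _ _ _ (congr_distr cb cm ca uv_b uv_ma)).
by move=> q /= [[_ //]|[bq aq]]; exact: abm.
Qed.

(** Primeness passes from binary to finite intersections; the empty one is
    excluded because a prime congruence is proper. *)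
Lemma prime_bigcap m (S : set (set (A * A))) :
  congruence_finite [set: A] -> prime_congr m ->
  (forall r, S r -> congruence setT r) ->
  [set p | forall r, S r -> r p] `<=` m -> exists2 r, S r & r `<=` m.
Proof.
move=> fin [cm [p mp] mprime] SP.
have /finite_seqP[s Ss] : finite_set S by apply: sub_finite_set fin.
move: SP; rewrite {}Ss {fin}.
elim: s => [_ Sm|r s IH SP Sm]; first by case: mp; exact: Sm.
have cs : congruence setT [set q | forall r', r' \in s -> r' q].
  by apply: congr_bigcap => r' r's; apply: SP; rewrite /= inE r's orbT.
have cr : congruence setT r by apply: SP; rewrite /= inE eqxx.
have [|rm|sm] := mprime _ _ cr cs.
- move=> q [rq sq]; apply: Sm => r' /=; rewrite inE => /orP[/eqP -> //|]; exact: sq.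
- by exists r; rewrite //= inE eqxx.
- have [|r' r's r'm] := IH _ sm.
    by move=> r' r's; apply: SP; rewrite /= inE r's orbT.
  by exists r'; rewrite //= inE r's orbT.
Qed.

End Primes.

(** * Lattices of closed sets *)

(** Closed sets serve to complete partial lattices: the generators stay apart as
    long as the principal sets are closed, and each closure rule imposes one
    inequality between joins of generators. *)
Section ClosedSets.
Variables (U : Type) (C : set (set U)).
Hypothesis C_bigcap : forall S : set (set U), S `<=` C -> C [set u | forall X, S X -> X u].

Let closed := {X : set U | C X}.
Let le (X Y : closed) := sval X `<=` sval Y.

Let le_anti X Y : le X Y -> le Y X -> X = Y.
Proof. by case: X Y => [X CX] [Y CY] XY YX; exact/eq_exist/seteqP. Qed.

Let inf_ex (X Y : closed) : exists m, forall Z, le Z m <-> le Z X /\ le Z Y.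
Proof.
have XYC : [set sval X; sval Y] `<=` C by move=> _ [] ->; exact: svalP.
exists (exist _ _ (C_bigcap XYC)) => Z; split.
  by move=> ZXY; split=> u /ZXY /=; apply; [left|right].
by move=> [ZX ZY] u Zu _ [] ->; [exact: ZX|exact: ZY].
Qed.

Let sup_ex (X Y : closed) : exists j, forall Z, le j Z <-> le X Z /\ le Y Z.
Proof.
pose S := [set Z | C Z /\ (sval X `<=` Z /\ sval Y `<=` Z)].
have SC : S `<=` C by move=> Z [].
exists (exist _ _ (C_bigcap SC)) => Z; split.
  by move=> jZ; split=> u hu; apply: jZ => /= V [_ [XV YV]]; [exact: XV|exact: YV].
by move=> [XZ YZ] u /=; apply; split; first exact: svalP.
Qed.

Definition closed_data : lat_data :=
  @LatData closed le (fun X => @subset_refl _ _) le_anti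
    (fun X Y Z => @subset_trans _ _ _ _) inf_ex sup_ex.

Definition closed_lat : latticeType cdisp := lat_of closed_data.

Definition mem_closed (X : closed_lat) : set U := sval (X : closed).

Lemma closed_leP (X Y : closed_lat) : X <= Y <-> mem_closed X `<=` mem_closed Y.
Proof. exact: latP. Qed.

Lemma mem_closedP (X : closed_lat) : C (mem_closed X).
Proof. exact: svalP. Qed.

Lemma closed_exists (X : set U) : C X -> exists x : closed_lat, mem_closed x = X.
Proof. by move=> CX; exists (exist _ X CX). Qed.

Definition closed_bot : closed_lat := exist _ _ (C_bigcap (@subset_refl _ C)).

Lemma closed_bot_le X : closed_bot <= X.
Proof. by apply/closed_leP => u; apply; exact: mem_closedP. Qed.

End ClosedSets.

(** * Adjoining relative complements *)

Section RelativeComplements.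
Variables (d : Order.disp_t) (M : latticeType d) (o : M).
Hypothesis o_le : forall x, o <= x.

Record flag := Flag { lo : M; mid : M; hi : M; lo_mid : lo <= mid; mid_hi : mid <= hi }.

(** Each flag [t] is a new generator, a relative complement of [mid t] in the
    interval from [lo t] to [hi t]: rules [fc_lo] and [fc_hi] put it between the
    two ends, and [fc_mid] makes its join with [mid t] reach [hi t].  No rule
    forces [t] to be below an element that is not above [hi t], which keeps its
    meet with [mid t] down to [lo t]. *)
Record flag_closed (X : set (M + flag)) : Prop := FlagClosed {
  fc_bot : X (inl o);
  fc_down : forall x y, x <= y -> X (inl y) -> X (inl x);
  fc_join : forall x y, X (inl x) -> X (inl y) -> X (inl (x `|` y));
  fc_lo : forall t, X (inr t) -> X (inl (lo t));
  fc_mid : forall t, X (inr t) -> X (inl (mid t)) -> X (inl (hi t));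
  fc_hi : forall t, X (inl (hi t)) -> X (inr t) }.

Lemma flag_closed_bigcap (S : set (set (M + flag))) :
  S `<=` flag_closed -> flag_closed [set u | forall X, S X -> X u].
Proof.
move=> SC; split=> /=.
- by move=> X SX; exact: (fc_bot (SC X SX)).
- by move=> x y xy h X SX; exact: (fc_down (SC X SX) xy (h X SX)).
- by move=> x y hx hy X SX; exact: (fc_join (SC X SX) (hx X SX) (hy X SX)).
- by move=> t h X SX; exact: (fc_lo (SC X SX) (h X SX)).
- by move=> t h h' X SX; exact: (fc_mid (SC X SX) (h X SX) (h' X SX)).
- by move=> t h X SX; exact: (fc_hi (SC X SX) (h X SX)).
Qed.

Definition compl_lat := closed_lat flag_closed_bigcap.

Definition below (x : M) : set (M + flag) :=
  fun u => match u with inl y => y <= x | inr t => hi t <= x end.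

Lemma below_closed x : flag_closed (below x).
Proof.
split=> //=.
- by move=> y z yz; exact: le_trans.
- by move=> y z yx zx; rewrite leUx yx.
- by move=> t; apply: le_trans; exact: le_trans (lo_mid t) (mid_hi t).
Qed.

Definition compl_emb (x : M) : compl_lat := exist _ _ (below_closed x).

Lemma compl_emb_le x (X : compl_lat) : compl_emb x <= X <-> mem_closed X (inl x).
Proof.
split=> [/closed_leP|Xx]; first by apply; rewrite /mem_closed /=.
have XC := mem_closedP X.
apply/closed_leP => -[y|t] /= h; first exact: (fc_down XC h).
by apply: (fc_hi XC); exact: (fc_down XC h).
Qed.

Lemma compl_emb_hom : lhom compl_emb.
Proof.
split=> x y; apply/esym.
  apply: meet_char; try by apply/compl_emb_le => /=; rewrite ?leIl ?leIr.
  move=> Z /closed_leP Zx /closed_leP Zy; apply/closed_leP => u Zu.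
  by move: (Zx u Zu) (Zy u Zu); case: u {Zu} => [z|t] /= hx hy; rewrite lexI; apply/andP.
apply: join_char; try by apply/compl_emb_le => /=; rewrite ?leUl ?leUr.
move=> Z /compl_emb_le Zx /compl_emb_le Zy; apply/compl_emb_le.
exact: (fc_join (mem_closedP Z)).
Qed.

Lemma compl_emb_inj : injective compl_emb.
Proof.
move=> x y exy; apply/le_anti/andP; split.
  by have /compl_emb_le : compl_emb x <= compl_emb y by rewrite exy.
by have /compl_emb_le : compl_emb y <= compl_emb x by rewrite exy.
Qed.

Lemma compl_emb_bot X : compl_emb o <= X.
Proof. by apply/compl_emb_le; exact: (fc_bot (mem_closedP X)). Qed.

(** For [a < b < c] the complement is the closed set generated by the flag, which
    is just the flag added to the principal set of [a]. *)
Lemma compl_emb_compl a b c : a <= b -> b <= c ->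
  exists x, compl_emb b `&` x = compl_emb a /\ compl_emb b `|` x = compl_emb c.
Proof.
move=> ab bc; have [EI EU] := compl_emb_hom.
have [ba|nba] := boolP (b <= a).
  exists (compl_emb c); have -> : a = b by apply/le_anti; rewrite ab.
  by rewrite -EI -EU (meet_idPl bc) (join_idPr bc).
have [cb|ncb] := boolP (c <= b).
  exists (compl_emb a); have -> : c = b by apply/le_anti; rewrite bc cb.
  by rewrite -EI -EU (meet_idPr ab) (join_idPl ab).
pose t := Flag ab bc.
have XC : flag_closed (below a `|` [set inr t]).
  have inlP (z : M) : (below a `|` [set inr t]) (inl z) -> z <= a by case.
  split=> [|x y xy|x y|s|s|s].
  - by left; exact: o_le.
  - by move=> /inlP ya; left; exact: le_trans ya.
  - by move=> /inlP xa /inlP ya; left; rewrite /= leUx xa.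
  - case=> [sa|[->]]; left; last exact: lexx.
    exact: (fc_lo (below_closed a) sa).
  - case=> [sa _|[->] /inlP]; last by move: nba => /= /negbTE ->.
    by left.
  - by move=> /inlP sa; left.
have [x xE] := closed_exists flag_closed_bigcap XC.
have ax : compl_emb a <= x by apply/compl_emb_le; rewrite xE; left => /=.
exists x; split.
  apply: meet_char => //; first by apply/compl_emb_le.
  move=> Z /closed_leP Zb /closed_leP; rewrite xE => Zx; apply/closed_leP => u Zu.
  case: (Zx u Zu) => // eu; move: (Zb u Zu); rewrite eu /= => cb.
  by rewrite cb in ncb.
apply: join_char; first exact/compl_emb_le.
  apply/closed_leP; rewrite xE => u [|->]; last exact: lexx.
  by case: u => [y|s] /= h; apply: (le_trans h); apply: (le_trans ab).
move=> Z /compl_emb_le Zb /closed_leP; rewrite xE => Zx; apply/compl_emb_le.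
by apply: (fc_mid (mem_closedP Z) (t := t)) => //; apply: Zx; right.
Qed.

End RelativeComplements.

(** * Simple extensions *)

(** The top is required to be join-reducible, for it is the joins reaching the
    top that let congruences propagate between coordinates in [glued]. *)
Record simple_lat := SimpleLat {
  slat :> latticeType cdisp;
  sbot : slat;
  stop : slat;
  sbot_le : forall x, sbot <= x;
  le_stop : forall x, x <= stop;
  s_simple : forall r, congruence [set: slat] r -> forall x y, r (x, y) -> x <> y ->
    r (sbot, stop);
  s_split : exists u v, [/\ u <> stop, v <> stop & u `|` v = stop] }.

Section Spikes.
Variables (d : Order.disp_t) (M : latticeType d) (o : M).
Hypothesis o_le : forall x, o <= x.

(** A summit is put above [M], and for each [a] in [M] countably many
    incomparable copies of the ideal generated by [a] are placed above that
    ideal.  An element [Spike a i x] is the join of [x] with an atom [(a, i)];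
    this atom joins to the summit with any other atom and with any element of
    [M] that is not below [a]. *)
Inductive spiked : Type :=
| Base of M
| Spike (a : M) (i : nat) (x : M) of x <= a
| Summit.

Definition spiked_le (u v : spiked) : Prop :=
  match u, v with
  | _, Summit => True
  | Summit, _ => False
  | Base x, Base y => x <= y
  | Base x, Spike _ _ y _ => x <= y
  | Spike _ _ _ _, Base _ => False
  | Spike a i x _, Spike b j y _ => (a, i) = (b, j) /\ x <= y
  end.

Let spiked_refl u : spiked_le u u. Proof. by case: u => /=. Qed.

Let spiked_anti u v : spiked_le u v -> spiked_le v u -> u = v.
Proof.
case: u v => [x|a i x xa|] [y|b j y yb|] //=.
  by move=> xy yx; congr Base; apply/le_anti/andP.
move=> [[eab eij] xy] [_ yx]; case: _ / eab yb => yb; case: _ / eij.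
have exy : x = y by apply/le_anti/andP.
by case: _ / exy yb => yb; rewrite (bool_irrelevance xa yb).
Qed.

Let spiked_trans u v w : spiked_le u v -> spiked_le v w -> spiked_le u w.
Proof.
case: u v w => [x|a i x xa|] [y|b j y yb|] [z|c k z zc|] //=.
- exact: le_trans.
- exact: le_trans.
- by move=> xy [_ yz]; exact: le_trans yz.
- by move=> [-> xy] [-> yz]; split=> //; exact: le_trans yz.
Qed.

Let inf_ex u v : exists m, forall w, spiked_le w m <-> spiked_le w u /\ spiked_le w v.
Proof.
case: u v => [x|a i x xa|] [y|b j y yb|].
- exists (Base (x `&` y)) => -[z|? ? ? ?|] /=; rewrite ?lexI; try by split=> // -[].
  by split=> /andP.
- exists (Base (x `&` y)) => -[z|? ? ? ?|] /=; rewrite ?lexI; try by split=> // -[].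
  by split=> /andP.
- by exists (Base x) => w; split=> [|[]]; case: w.
- exists (Base (x `&` y)) => -[z|? ? ? ?|] /=; rewrite ?lexI; try by split=> // -[].
  by split=> /andP.
- case: (pselect ((a, i) = (b, j))) => [[eab eij]|nab].
    have xya : x `&` y <= a by rewrite (le_trans _ xa) ?leIl.
    exists (Spike i xya) => -[z|c k z zc|] /=; rewrite ?lexI; last by split=> // -[].
      by split=> /andP.
    rewrite -eab -eij; split=> [[-> /andP[]]|[[-> zx] [_ zy]]] //.
    by split=> //; rewrite zx.
  exists (Base (x `&` y)) => -[z|c k z zc|] /=; rewrite ?lexI; last by split=> // -[].
    by split=> /andP.
  by split=> // -[[e1 _] [e2 _]]; apply: nab; rewrite -e1 -e2.
- by exists (Spike i xa) => w; split=> [|[]]; case: w.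
- by exists (Base y) => w; split=> [|[]]; case: w.
- by exists (Spike j yb) => w; split=> [|[]]; case: w.
- by exists Summit => w; split=> [|[]]; case: w.
Qed.

Let sup_ex u v : exists j, forall w, spiked_le j w <-> spiked_le u w /\ spiked_le v w.
Proof.
have mixed (x : M) a i (y : M) (ya : y <= a) : exists j, forall w,
    spiked_le j w <-> spiked_le (Base x) w /\ spiked_le (Spike i ya) w.
  have [xa|nxa] := boolP (x `|` y <= a).
    exists (Spike i xa) => -[z|c k z zc|] /=; try by split=> // -[].
    by rewrite leUx; split=> [[-> /andP[]]|[? [-> ?]]] //; split=> //; apply/andP.
  exists Summit => -[z|c k z zc|] /=; split=> // -[] // xz [[eac _] yz].
  by move: nxa; rewrite eac (le_trans _ zc) // leUx xz.
case: u v => [x|a i x xa|] [y|b j y yb|].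
- exists (Base (x `|` y)) => -[z|? ? ? ?|] /=; rewrite ?leUx //.
    by split=> /andP.
  by split=> /andP.
- exact: mixed.
- by exists Summit => w; split=> [|[]]; case: w.
- by have [m mP] := mixed y _ i _ xa; exists m => w; rewrite mP; split=> -[].
- case: (pselect ((a, i) = (b, j))) => [[eab eij]|nab].
    have xya : x `|` y <= a by rewrite leUx xa eab.
    exists (Spike i xya) => -[z|c k z zc|] /=; try by split=> // -[].
    rewrite leUx -eab -eij; split=> [[-> /andP[]]|[[-> ?] [_ ?]]] //.
    by split=> //; apply/andP.
  exists Summit => -[z|c k z zc|] /=; split=> // -[] // [e1 _] [e2 _].
  by apply: nab; rewrite e1 e2.
- by exists Summit => w; split=> [|[]]; case: w.
- by exists Summit => w; split=> [|[]]; case: w.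
- by exists Summit => w; split=> [|[]]; case: w.
- by exists Summit => w; split=> [|[]]; case: w.
Qed.

Definition spiked_data : lat_data := LatData spiked_refl spiked_anti spiked_trans inf_ex sup_ex.
Definition spiked_lat : latticeType cdisp := lat_of spiked_data.


Definition base (x : M) : spiked_lat := Base x.
Definition spike a i x (xa : x <= a) : spiked_lat := Spike i xa.
Definition summit : spiked_lat := Summit.

Lemma base_hom : lhom base.
Proof.
split=> x y; apply/esym.
  apply: meet_char; try by apply/latP; rewrite /= ?leIl ?leIr.
  move=> [z|a i z za|] /latP /= zx /latP //= zy.
  by apply/latP; rewrite /= lexI zx.
apply: join_char; try by apply/latP; rewrite /= ?leUl ?leUr.
move=> [z|a i z za|] /latP /= zx /latP //= zy; apply/latP => //=; by rewrite leUx zx.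
Qed.

Lemma base_inj : injective base.
Proof. by move=> x y []. Qed.

Lemma base_bot u : base o <= u.
Proof. by apply/latP; case: u => /=. Qed.

Lemma le_summit u : u <= summit.
Proof. by apply/latP; case: u. Qed.

Let tip a i := spike i (o_le a).

Let meet_tip a i x : base x `&` tip a i = base o.
Proof.
apply: meet_char; try exact: base_bot.
by move=> [z|? ? ? ?|] /latP /= ? /latP /= ?; apply/latP.
Qed.

Let spike_meet_tip a i x (xa : x <= a) b j : (a, i) <> (b, j) ->
  spike i xa `&` tip b j = base o.
Proof.
move=> ne; apply: meet_char; try exact: base_bot.
move=> [z|c k z zc|] /latP /= h1 /latP /= h2; apply/latP => //=.
by apply: ne; case: h1 h2 => <- _ [<-].
Qed.

Let tip_join a i b j : (a, i) <> (b, j) -> tip a i `|` tip b j = summit.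
Proof.
move=> ne; apply: join_char; try exact: le_summit.
move=> [z|c k z zc|] /latP /= h1 /latP /= h2; apply/latP => //=.
by apply: ne; case: h1 h2 => -> _ [->].
Qed.

Section SpikedSimple.
Variables (r : set (spiked_lat * spiked_lat)) (cr : congruence setT r).

(** As soon as one atom collapses, so does everything: the join of two atoms is
    the summit and their meet is the bottom. *)
Let tip_collapse a i : r (base o, tip a i) -> r (base o, summit).
Proof.
move=> h.
have ne j k : (j < k)%N -> (a, j) <> (a, k) by move=> + [jk]; rewrite jk ltnn.
have nij := ne _ _ (ltnSn i); have njk := ne _ _ (ltnSn i.+1).
have nik := ne _ _ (ltnW (ltnSn i.+1)).
(* joining with another tip and meeting with a third one *)
have hj : r (tip a i.+1, summit).
  have := congr_joinr (tip a i.+1) cr h.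
  by rewrite (tip_join nij) (join_idPr (base_bot _)).
have hk : r (base o, tip a i.+2).
  have := congr_meetr (tip a i.+2) cr hj.
  by rewrite (spike_meet_tip _ njk) (meet_idPr (le_summit _)).
have := congr_join cr h hk.
by rewrite (tip_join nik) joinxx.
Qed.

Let summit_collapse u : r (u, summit) -> u <> summit -> r (base o, summit).
Proof.
move=> h us.
have [a [i ai]] : exists a i, u `&` tip a i = base o.
  case: u us {h} => [x|a i x xa|//] _; first by exists o, 0; exact: meet_tip.
  by exists a, i.+1; apply: spike_meet_tip => -[]; exact: n_Sn.
have := congr_meetr (tip a i) cr h.
rewrite ai (meet_idPr (le_summit _)); exact: tip_collapse.
Qed.

(** If [x < y], an atom attached to [x] tells them apart: its join with [y] is
    the summit, its join with [x] is not. *)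
Let base_collapse x y : r (base x, base y) -> x < y -> r (base o, summit).
Proof.
move=> h xy; pose s := spike 0 (lexx x).
have := congr_joinr s cr h.
have -> : base x `|` s = s by apply/join_idPr/latP => /=.
have -> : base y `|` s = summit.
  apply: join_char; try exact: le_summit.
  move=> [z|c k z zc|] /latP /= h1 /latP //= h2; apply/latP => //=.
  case: h2 => [[e _] _]; have := le_trans h1 zc.
  by rewrite -e (lt_geF xy).
by move=> /summit_collapse; apply.
Qed.

Let lt_collapse u v : r (u, v) -> u < v -> r (base o, summit).
Proof.
have spike_meet_base a i y (ya : y <= a) x (xa : x <= a) :
    x <= y -> spike i xa `&` base y = base x.
  move=> xy; apply: meet_char; try by apply/latP; rewrite /= ?lexx.
  by move=> [z|c k z zc|] /latP /= zx /latP /= zy; apply/latP.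
case: v => [y|a i y ya|] h uv; last first.
- by apply: (summit_collapse h) => us; rewrite us ltxx in uv.
- case: u h uv => [x|b j x xb|] h uv.
  + have := congr_meetr (tip a i) cr h.
    have -> : spike i ya `&` tip a i = tip a i by apply/meet_idPr/latP => /=.
    by rewrite meet_tip; exact: tip_collapse.
  + have /latP [[eab eij] xy] := ltW uv.
    have := congr_meetr (base y) cr h; subst b.
    rewrite !spike_meet_base // => hxy; apply: (base_collapse hxy).
    rewrite lt_neqAle xy andbT; apply/eqP => exy.
    subst x j; move: uv; rewrite (bool_irrelevance xb ya) ltxx //.
  + by have /latP := ltW uv.
- case: u h uv => [x|b j x xb|] h uv.
  + have /latP xy := ltW uv; apply: (base_collapse h); rewrite lt_neqAle.
    by apply/andP; split=> //; apply/eqP => exy; rewrite exy ltxx in uv.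
  + by have /latP := ltW uv.
  + by have /latP := ltW uv.
Qed.

Lemma spiked_simple u v : r (u, v) -> u <> v -> r (base o, summit).
Proof.
move=> h uv; apply: (@lt_collapse (u `&` v) (u `|` v)).
  apply: (congr_trans cr (y := u)).
    by have := congr_meetr u cr (congr_sym cr h); rewrite meetxx meetC.
  by have := congr_joinr u cr h; rewrite joinxx joinC.
rewrite lt_neqAle (le_trans (leIl _ _) (leUl _ _)) andbT.
apply/negP => /eqP e; apply: uv; apply/le_anti/andP; split.
  by apply: (le_trans (leUl u v)); rewrite -e leIr.
by apply: (le_trans (leUr v u)); rewrite -e leIl.
Qed.

End SpikedSimple.

Lemma spiked_split : exists u v : spiked_lat,
  [/\ u <> summit, v <> summit & u `|` v = summit].
Proof. by exists (tip o 0), (tip o 1); split=> //; apply: tip_join => -[]. Qed.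

Definition spiked_simple_lat : simple_lat :=
  SimpleLat base_bot le_summit spiked_simple spiked_split.

End Spikes.

(** * Prescribing the congruence lattice *)

Section Gluing.
Variables (P : choiceType) (leP : P -> P -> Prop) (T : P -> simple_lat).
Hypothesis leP_refl : forall p, leP p p.
Hypothesis leP_trans : forall p q s, leP p q -> leP q s -> leP p s.
Hypothesis leP_anti : forall p q, leP p q -> leP q p -> p = q.
Variable enumP : seq P.
Hypothesis enumPP : forall p, p \in enumP.

(** The product, cut down so that collapsing the coordinate [q] must collapse
    all the coordinates [p] below [q].  The condition survives meets; for a join
    one computes coordinatewise, then raises to the top the coordinates below
    those that have become the top. *)
Let prod := {x : forall p, T p | forall p q, leP p q -> x q = stop (T q) -> x p = stop (T p)}.
Let le (x y : prod) := forall p, sval x p <= sval y p.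

Let glued_anti x y : le x y -> le y x -> x = y.
Proof.
case: x y => [x xP] [y yP] xy yx; apply: eq_exist; apply: functional_extensionality_dep => p.
by apply/le_anti; rewrite xy yx.
Qed.

Let glued_trans x y z : le x y -> le y z -> le x z.
Proof. by move=> xy yz p; exact: le_trans (xy p) (yz p). Qed.

Let inf_ex_at (x y : prod) : exists m : prod,
  (forall z, le z m <-> le z x /\ le z y) /\
  (forall p, sval m p = sval x p `&` sval y p).
Proof.
have mP p q : leP p q -> sval x q `&` sval y q = stop (T q) ->
    sval x p `&` sval y p = stop (T p).
  move=> pq xyq.
  have h (u v : T q) : u `&` v = stop (T q) -> u = stop (T q).
    by move=> uv; apply/le_anti; rewrite le_stop -uv leIl.
  rewrite (svalP x _ _ pq (h _ _ xyq)) (svalP y _ _ pq); first by rewrite meetxx.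
  by apply: h; rewrite meetC; exact: xyq.
exists (exist _ (fun p => sval x p `&` sval y p) mP); split=> // z; split.
  by move=> h; split=> p; apply: (le_trans (h p)); rewrite ?leIl ?leIr.
by move=> [zx zy] p; rewrite lexI zx zy.
Qed.

Let inf_ex (x y : prod) : exists m, forall z, le z m <-> le z x /\ le z y.
Proof. by have [m [mP _]] := inf_ex_at x y; exists m. Qed.

Let joined (x y : prod) p := exists2 q, leP p q & sval x q `|` sval y q = stop (T q).

Let sup_ex_at (x y : prod) : exists j : prod,
  (forall z, le j z <-> le x z /\ le y z) /\
  (forall p, ~ joined x y p -> sval j p = sval x p `|` sval y p).
Proof.
pose j p := if `[< joined x y p >] then stop (T p) else sval x p `|` sval y p.
have jin p : joined x y p -> j p = stop (T p) by rewrite /j; case: asboolP.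
have jout p : ~ joined x y p -> j p = sval x p `|` sval y p by rewrite /j; case: asboolP.
have jP p q : leP p q -> j q = stop (T q) -> j p = stop (T p).
  move=> pq jq; apply: jin; have [[s qs xys]|nq] := pselect (joined x y q).
    by exists s => //; exact: leP_trans qs.
  by exists q => //; rewrite -jout.
have le_j z : sval x z `|` sval y z <= j z.
  by rewrite /j; case: asboolP => // _; exact: le_stop.
exists (exist _ j jP); split=> //.
move=> z; split=> [jz|[xz yz] p].
  split=> p; apply: (le_trans _ (jz p)); apply: (le_trans _ (le_j p)).
    exact: leUl.
  exact: leUr.
have [[q pq xyq]|np] /= := pselect (joined x y p); last by rewrite jout // leUx xz yz.
rewrite (svalP z _ _ pq) ?le_stop //; apply/le_anti; rewrite le_stop -xyq leUx.
by rewrite xz yz.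
Qed.

Let sup_ex (x y : prod) : exists j, forall z, le j z <-> le x z /\ le y z.
Proof. by have [j [jP _]] := sup_ex_at x y; exists j. Qed.

Definition glued_data : lat_data :=
  @LatData prod le (fun x p => lexx _) glued_anti glued_trans inf_ex sup_ex.
Definition glued : latticeType cdisp := lat_of glued_data.

Definition coord (x : glued) (p : P) : T p := sval (x : prod) p.

Lemma coordP (x : glued) p q : leP p q -> coord x q = stop (T q) -> coord x p = stop (T p).
Proof. exact: (svalP x). Qed.

Lemma glued_leP (x y : glued) : x <= y <-> forall p, coord x p <= coord y p.
Proof. exact: latP. Qed.

Lemma coord_le (x y : glued) p : x <= y -> coord x p <= coord y p.
Proof. by move=> /glued_leP. Qed.

Lemma glued_ext (x y : glued) : (forall p, coord x p = coord y p) -> x = y.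
Proof. by move=> xy; apply/le_anti/andP; split; apply/glued_leP => p; rewrite xy. Qed.

Lemma glued_exists (x : forall p, T p) :
  (forall p q, leP p q -> x q = stop (T q) -> x p = stop (T p)) ->
  exists y : glued, forall p, coord y p = x p.
Proof. by move=> xP; exists (exist _ x xP). Qed.

Lemma coord_meet (x y : glued) p : coord (x `&` y) p = coord x p `&` coord y p.
Proof.
have [m [mP mE]] := inf_ex_at x y.
have -> : x `&` y = (m : glued).
  have [mx my] := (mP m).1 (fun p => lexx _).
  apply: meet_char; [exact/latP|exact/latP|].
  by move=> z /latP zx /latP zy; apply/latP; exact/mP.
exact: mE.
Qed.

Lemma coord_join_out (x y : glued) p :
  ~ (exists2 q, leP p q & coord x q `|` coord y q = stop (T q)) ->
  coord (x `|` y) p = coord x p `|` coord y p.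
Proof.
have [j [jP jE]] := sup_ex_at x y => np.
have -> : x `|` y = (j : glued).
  have [xj yj] := (jP j).1 (fun p => lexx _).
  apply: join_char; [exact/latP|exact/latP|].
  by move=> z /latP xz /latP yz; apply/latP; exact/jP.
exact: jE.
Qed.

Lemma coord_join_in (x y : glued) p q : leP p q ->
  coord x q `|` coord y q = stop (T q) -> coord (x `|` y) p = stop (T p).
Proof.
move=> pq xyq; apply: (coordP pq); apply/le_anti; rewrite le_stop -xyq leUx.
by rewrite !coord_le ?leUl ?leUr.
Qed.


Definition agree (X : set P) : set (glued * glued) :=
  [set xy | forall p, ~ X p -> coord xy.1 p = coord xy.2 p].

Definition down_closed (X : set P) := forall p q, leP p q -> X q -> X p.

(** A coordinate of a join depends only on the coordinates above it, none of
    which is in a down-set that the given one avoids. *)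
Lemma agree_congr X : down_closed X -> congruence setT (agree X).
Proof.
move=> Xdown; split=> //=.
- by move=> x y xy p /xy.
- by move=> x y z xy yz p Xp; rewrite xy ?yz.
- by move=> x1 y1 x2 y2 h1 h2 p Xp; rewrite /= !coord_meet h1 ?h2.
- move=> x1 y1 x2 y2 h1 h2 p Xp /=.
  have eq q : leP p q -> coord x1 q `|` coord x2 q = coord y1 q `|` coord y2 q.
    by move=> pq; rewrite h1 ?h2 // => Xq; apply: Xp; exact: Xdown pq Xq.
  have [[q pq xq]|np] := pselect (exists2 q, leP p q & coord x1 q `|` coord x2 q = stop (T q)).
    by rewrite (coord_join_in pq xq) (coord_join_in pq (etrans (esym (eq q pq)) xq)).
  rewrite !coord_join_out ?eq // => -[q pq yq].
  by apply: np; exists q; rewrite // eq.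
Qed.

Let bot_neq_stop p : sbot (T p) <> stop (T p).
Proof.
have [u [v [us _ _]]] := s_split (T p) => bs; apply: us.
by apply/le_anti; rewrite le_stop -bs sbot_le.
Qed.

Lemma glued_bot_exists : exists x : glued, forall p, coord x p = sbot (T p).
Proof. by apply: glued_exists => p q _ /bot_neq_stop. Qed.

Let single_ex p (y : T p) : y <> stop (T p) ->
  exists x : glued, coord x p = y /\ forall q, q != p -> coord x q = sbot (T q).
Proof.
move=> ys; pose x := dfwith (fun q => sbot (T q)) y.
have xp : x p = y by rewrite /x dfwith_in.
have xq q : q != p -> x q = sbot (T q) by move=> qp; rewrite /x dfwith_out // eq_sym.
have [|z zx] := @glued_exists x.
  move=> q s _; have [->|sp] := eqVneq s p; first by rewrite xp.
  by rewrite (xq s sp) => /bot_neq_stop.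
by exists z; split=> [|q qp]; rewrite zx ?xp ?xq.
Qed.

(** [T p] embeds in [glued] at the coordinate [p], provided the coordinates
    below [p] are set to the top and the others to the bottom. *)
Let spread_ex p (y : T p) : exists x : glued, [/\ coord x p = y,
  forall q, q != p -> leP q p -> coord x q = stop (T q) &
  forall q, ~ leP q p -> coord x q = sbot (T q)].
Proof.
pose x := dfwith (fun q => if `[< leP q p >] then stop (T q) else sbot (T q)) y.
have xp : x p = y by rewrite /x dfwith_in.
have xlt q : q != p -> leP q p -> x q = stop (T q).
  by move=> qp lqp; rewrite /x dfwith_out 1?eq_sym //; case: asboolP.
have xnle q : ~ leP q p -> x q = sbot (T q).
  move=> nqp; rewrite /x dfwith_out; first by case: asboolP.
  by apply/eqP => pq; apply: nqp; rewrite pq.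
have [|z zx] := @glued_exists x.
  move=> q s qs xs; have sp : leP s p.
    by apply: contrapT => nsp; move: xs; rewrite xnle //; exact: bot_neq_stop.
  have [eqp|qp] := eqVneq q p; last by apply: xlt => //; exact: leP_trans sp.
  by move: qs xs; rewrite {}eqp => ps; rewrite (leP_anti ps sp).
by exists z; split=> [|q qp lqp|q qp]; rewrite zx; auto.
Qed.

Section GluedCongruences.
Variables (r : set (glued * glued)) (cr : congruence setT r).

Let bot := sval (cid glued_bot_exists).
Let coord_bot p : coord bot p = sbot (T p).
Proof. by rewrite /bot; case: cid. Qed.

Let bot_le x : bot <= x.
Proof. by apply/glued_leP => p; rewrite coord_bot sbot_le. Qed.

Let spread p (y : T p) := sval (cid (spread_ex y)).

Let spread_at p (y : T p) : coord (spread y) p = y.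
Proof. by rewrite /spread; case: cid => ? []. Qed.

Let spread_below p (y : T p) q : q != p -> leP q p -> coord (spread y) q = stop (T q).
Proof. by rewrite /spread; case: cid => ? [? h ?]; exact: h. Qed.

Let spread_out p (y : T p) q : ~ leP q p -> coord (spread y) q = sbot (T q).
Proof. by rewrite /spread; case: cid => ? [? ? h]; exact: h. Qed.

Let spread_le p (y : T p) (z : glued) : spread y <= z <->
  y <= coord z p /\ forall q, q != p -> leP q p -> coord z q = stop (T q).
Proof.
split=> [/glued_leP h|[yz zq]].
  split=> [|q qp lqp]; first by have := h p; rewrite spread_at.
  by apply/le_anti; rewrite le_stop /=; have := h q; rewrite spread_below.
apply/glued_leP => q; have [->|qp] := eqVneq q p; first by rewrite spread_at.
have [lqp|nqp] := pselect (leP q p); first by rewrite (zq q) ?le_stop.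
by rewrite spread_out ?sbot_le.
Qed.

Let spread_hom p : lhom (@spread p).
Proof.
split=> x y.
  apply: glued_ext => q; rewrite coord_meet.
  have [->|qp] := eqVneq q p; first by rewrite !spread_at.
  have [lqp|nqp] := pselect (leP q p); first by rewrite !spread_below // meetxx.
  by rewrite !spread_out // meetxx.
apply/esym; apply: join_char.
- by apply/spread_le; rewrite spread_at leUl; split=> // q; exact: spread_below.
- by apply/spread_le; rewrite spread_at leUr; split=> // q; exact: spread_below.
- move=> z /spread_le[xz zq] /spread_le[yz _]; apply/spread_le.
  by rewrite leUx xz yz.
Qed.

(** A pair that differs at [p] cuts down to a pair in the copy of [T p], which is
    simple, so the bottom and the top of this copy are identified.  Writing the
    top of [T p] as [u] join [v], both smaller than the top, the elements that
    are [u] or [v] at [p] and bottom elsewhere are then identified with the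
    bottom; yet their join is the top at all the coordinates below [p]. *)
Let collapse p x y : r (x, y) -> coord x p <> coord y p ->
  r (bot, spread (stop (T p))).
Proof.
move=> xy nxy.
(* cutting a pair down to the coordinate [p] *)
have cut x0 : (x0 `&` spread (stop (T p))) `|` spread (sbot (T p)) = spread (coord x0 p).
  apply: join_char.
  - apply/glued_leP => q; rewrite coord_meet.
    have [->|qp] := eqVneq q p; first by rewrite !spread_at leIl.
    have [lqp|nqp] := pselect (leP q p); first by rewrite !spread_below // leIr.
    by rewrite !spread_out // leIr.
  - by apply/spread_le; rewrite spread_at sbot_le; split=> // q; exact: spread_below.
  - move=> z /glued_leP h /spread_le[_ zq]; apply/spread_le; split=> //.
    by have := h p; rewrite coord_meet spread_at (meet_idPl (le_stop _)).
have hxy : r (spread (coord x p), spread (coord y p)).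
  by rewrite -!cut; apply: congr_joinr => //; exact: congr_meetr.
have ends := s_simple (congr_preimage (spread_hom p) cr) hxy nxy.
rewrite /restriction /= in ends.
have [u [v [us vs uv]]] := s_split (T p).
have [su [sup suq]] := single_ex us; have [sv [svp svq]] := single_ex vs.
have single_le s w : (forall q, q != p -> coord s q = sbot (T q)) ->
    (s <= w) = (coord s p <= coord w p).
  move=> sq; apply/idP/idP => [/glued_leP //|sw]; apply/glued_leP => q.
  by have [->|qp] := eqVneq q p => //; rewrite sq ?sbot_le.
have below_top s : (forall q, q != p -> coord s q = sbot (T q)) ->
    s <= spread (stop (T p)).
  by move=> sq; rewrite single_le // spread_at le_stop.
have meet_bot s : (forall q, q != p -> coord s q = sbot (T q)) ->
    spread (sbot (T p)) `&` s = bot.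
  move=> sq; apply/le_anti; rewrite bot_le andbT; apply/glued_leP => q.
  rewrite coord_meet coord_bot; have [->|qp] := eqVneq q p.
    by rewrite spread_at leIl.
  by rewrite sq ?leIr.
have drop s : (forall q, q != p -> coord s q = sbot (T q)) -> r (bot, s).
  move=> sq; have := congr_meetr s cr ends.
  by rewrite (meet_bot _ sq) (meet_idPr (below_top _ sq)).
have -> : spread (stop (T p)) = su `|` sv.
  apply/esym; apply: join_char; try exact: below_top.
  move=> z suz svz; apply/spread_le.
  have zp : coord z p = stop (T p).
    apply/le_anti; rewrite le_stop -uv leUx -sup -svp.
    by rewrite -!single_le ?suz.
  by split=> [|q qp lqp]; [rewrite zp|exact: coordP zp].
by have := congr_join cr (drop _ suq) (drop _ svq); rewrite joinxx.
Qed.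

Definition collapsed : set P := [set p | exists x y, r (x, y) /\ coord x p <> coord y p].

Let collapsed_down : down_closed collapsed.
Proof.
move=> q p qp [x [y [xy nxy]]]; exists bot, (spread (stop (T p))).
split; first exact: collapse xy nxy.
rewrite coord_bot; have [->|q_p] := eqVneq q p; first by rewrite spread_at; exact: bot_neq_stop.
by rewrite spread_below //; exact: bot_neq_stop.
Qed.

(** This is where the finiteness of [P] enters: joining the collapsed elements
    provided by [collapse], one for each coordinate, stays in the congruence
    class of the bottom. *)
Let collapsed_top : exists t, [/\ r (bot, t),
  forall q, collapsed q -> coord t q = stop (T q) &
  forall q, ~ collapsed q -> coord t q = sbot (T q)].
Proof.
suff [t [rt tin tout]] : exists t, [/\ r (bot, t),
    forall q, q \in enumP -> collapsed q -> coord t q = stop (T q) &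
    forall q, ~ collapsed q -> coord t q = sbot (T q)].
  by exists t; split=> // q; exact: tin.
elim: enumP => [|p s [t [rt tin tout]]].
  by exists bot; split=> //; exact: (congr_refl cr).
have [Xp|nXp] := pselect (collapsed p); last first.
  exists t; split=> // q; rewrite inE => /orP[/eqP -> //|]; exact: tin.
have [x [y [xy nxy]]] := Xp.
exists (t `|` spread (stop (T p))); split.
- by have := congr_join cr rt (collapse xy nxy); rewrite joinxx.
- move=> q; rewrite inE => qs Xq; apply/le_anti; rewrite le_stop /=.
  case/orP: qs => [/eqP eq|qs].
    have /glued_leP/(_ p) : spread (stop (T p)) <= t `|` spread (stop (T p)) by exact: leUr.
    by rewrite spread_at eq.
  by rewrite -(tin q qs Xq); apply: coord_le; exact: leUl.
- move=> q nXq; have out u : leP q u -> coord t u `|` coord (spread (stop (T p))) u = sbot (T u).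
    move=> qu; have nXu : ~ collapsed u by move=> Xu; apply: nXq; exact: collapsed_down qu Xu.
    rewrite tout // spread_out ?joinxx // => up.
    by apply: nXu; exact: collapsed_down up Xp.
  rewrite coord_join_out ?out // => -[u qu]; rewrite out //; exact: bot_neq_stop.
Qed.

(** Hence the congruences of [glued] correspond to the down-sets of [P]: joining
    with the element that is the top on the collapsed coordinates and the bottom
    elsewhere makes equal any two elements that agree off these coordinates. *)
Lemma glued_congr : down_closed collapsed /\ r = agree collapsed.
Proof.
split=> //; apply/seteqP; split=> [[x y] xy p np|[x y] /= xy].
  by apply: contrapT => nxy; apply: np; exists x, y.
have [t [rt tin tout]] := collapsed_top.
have xt z : r (z, z `|` t).
  by have := congr_joinl z cr rt; rewrite (join_idPl (bot_le _)).
have coord_t z q : ~ collapsed q -> coord (z `|` t) q = coord z q.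
  move=> nXq; have out u : leP q u -> coord z u `|` coord t u = coord z u.
    move=> qu; rewrite tout; first by apply/join_idPl; exact: sbot_le.
    by move=> Xu; apply: nXq; exact: collapsed_down qu Xu.
  have [[u qu zu]|nu] := pselect (exists2 u, leP q u & coord z u `|` coord t u = stop (T u)).
    by rewrite (coord_join_in qu zu) (coordP qu) // -out.
  by rewrite coord_join_out ?out.
apply: (congr_trans cr (xt x)); have -> : x `|` t = y `|` t.
  apply: glued_ext => q; have [Xq|nXq] := pselect (collapsed q); last by rewrite !coord_t ?xy.
  have top z : coord (z `|` t) q = stop (T q).
    by apply/le_anti; rewrite le_stop -(tin q Xq) /=; apply: coord_le; exact: leUr.
  by rewrite !top.
by apply: (congr_sym cr).
Qed.

End GluedCongruences.
End Gluing.

Section GluedLift.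
Variables (P : choiceType) (leP : P -> P -> Prop) (T : P -> simple_lat).
Hypothesis leP_trans : forall p q s, leP p q -> leP q s -> leP p s.

(** No join of values ever reaches a top, so joins are computed
    coordinatewise. *)
Lemma glued_lift d (A : latticeType d) (h : forall p, A -> T p) :
  (forall p, lhom (h p)) -> (forall p a, h p a <> stop (T p)) ->
  exists2 H : A -> glued T leP_trans, lhom H & forall a p, coord (H a) p = h p a.
Proof.
move=> hh hs.
have ex a : exists x : glued T leP_trans, forall p, coord x p = h p a.
  by apply: glued_exists => p q _ /hs.
exists (fun a => proj1_sig (cid (ex a))); last by move=> a p; case: cid.
split=> a b; case: cid => x xE; case: cid => u uE; case: cid => v vE /=;
  apply: glued_ext => p; rewrite xE.
  by rewrite coord_meet uE vE (hh p).1.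
rewrite coord_join_out ?uE ?vE ?(hh p).2 // => -[q _].
by rewrite uE vE -(hh q).2; exact: hs.
Qed.

End GluedLift.

(** * Amalgamation *)

Section Amalgam.
Variables (dC dA dB : Order.disp_t).
Variables (C : latticeType dC) (A : latticeType dA) (B : latticeType dB).
Variables (f : C -> A) (g : C -> B) (r : set (A * A)) (s : set (B * B)) (Z : set C).
Hypotheses (fh : lhom f) (gh : lhom g).
Hypotheses (cr : congruence setT r) (cs : congruence setT s).
Hypothesis rs : forall c c', r (f c, f c') <-> s (g c, g c').
Hypothesis Zf : forall c a, Z c -> f c <= a.
Hypothesis Zg : forall c b, Z c -> g c <= b.

Let le_f_g c c' : le_mod r (f c) (f c') <-> le_mod s (g c) (g c').
Proof. by rewrite /le_mod -fh.1 -gh.1; exact: rs. Qed.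

(** The quotients of [A] by [r] and of [B] by [s] share the quotient of [C] by
    the common trace of [r] and [s]; elements of different sides are compared
    through [C]. *)
Definition amalg_le (u v : A + B) : Prop :=
  match u, v with
  | inl a, inl a' => le_mod r a a'
  | inl a, inr b => exists2 c, le_mod r a (f c) & le_mod s (g c) b
  | inr b, inl a => exists2 c, le_mod s b (g c) & le_mod r (f c) a
  | inr b, inr b' => le_mod s b b'
  end.

Let tr_r := le_mod_trans cr.
Let tr_s := le_mod_trans cs.

Lemma amalg_le_trans u v w : amalg_le u v -> amalg_le v w -> amalg_le u w.
Proof.
case: u v w => [a|b] [a'|b'] [a''|b''] /=.
- exact: tr_r.
- by move=> aa' [c a'c cb]; exists c => //; exact: tr_r a'c.
- move=> [c ac cb] [c' bc' ca]; apply: (tr_r ac); apply: tr_r ca.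
  by apply/le_f_g; exact: tr_s bc'.
- by move=> [c ac cb] bb; exists c => //; exact: tr_s bb.
- by move=> [c bc ca] aa; exists c => //; exact: tr_r aa.
- move=> [c bc ca] [c' ac' cb]; apply: (tr_s bc); apply: tr_s cb.
  by apply/le_f_g; exact: tr_r ac'.
- by move=> bb' [c b'c ca]; exists c => //; exact: tr_s b'c.
- exact: tr_s.
Qed.

Lemma amalg_le_refl u : amalg_le u u.
Proof. by case: u => x; apply: le_modW. Qed.

Lemma amalg_le_meetA u a a' :
  amalg_le u (inl a) -> amalg_le u (inl a') -> amalg_le u (inl (a `&` a')).
Proof.
case: u => [x|x] /=; first exact: le_mod_meet.
move=> [c xc ca] [c' xc' ca']; exists (c `&` c').
  by rewrite gh.1; exact: le_mod_meet.
rewrite fh.1; apply: le_mod_meet => //; [apply: tr_r ca|apply: tr_r ca'];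
  by apply: le_modW; rewrite ?leIl ?leIr.
Qed.

Lemma amalg_le_meetB u b b' :
  amalg_le u (inr b) -> amalg_le u (inr b') -> amalg_le u (inr (b `&` b')).
Proof.
case: u => [x|x] /=; last exact: le_mod_meet.
move=> [c xc ca] [c' xc' ca']; exists (c `&` c').
  by rewrite fh.1; exact: le_mod_meet.
rewrite gh.1; apply: le_mod_meet => //; [apply: tr_s ca|apply: tr_s ca'];
  by apply: le_modW; rewrite ?leIl ?leIr.
Qed.

Lemma amalg_le_joinA a a' u :
  amalg_le (inl a) u -> amalg_le (inl a') u -> amalg_le (inl (a `|` a')) u.
Proof.
case: u => [x|x] /=; first exact: le_mod_join.
move=> [c xc ca] [c' xc' ca']; exists (c `|` c'); last first.
  by rewrite gh.2; exact: le_mod_join.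
rewrite fh.2; apply: le_mod_join => //; [apply: (tr_r xc)|apply: (tr_r xc')];
  by apply: le_modW; rewrite ?leUl ?leUr.
Qed.

Lemma amalg_le_joinB b b' u :
  amalg_le (inr b) u -> amalg_le (inr b') u -> amalg_le (inr (b `|` b')) u.
Proof.
case: u => [x|x] /=; last exact: le_mod_join.
move=> [c xc ca] [c' xc' ca']; exists (c `|` c'); last first.
  by rewrite fh.2; exact: le_mod_join.
rewrite gh.2; apply: le_mod_join => //; [apply: (tr_s xc)|apply: (tr_s xc')];
  by apply: le_modW; rewrite ?leUl ?leUr.
Qed.

(** Common ideals of both sides.  The images of [Z] lie in all of them, which
    makes these images least in the amalgam. *)
Record amalg_closed (X : set (A + B)) : Prop := AmalgClosed {
  ac_down : forall u v, amalg_le u v -> X v -> X u;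
  ac_joinA : forall a a', X (inl a) -> X (inl a') -> X (inl (a `|` a'));
  ac_joinB : forall b b', X (inr b) -> X (inr b') -> X (inr (b `|` b'));
  ac_zero : forall c, Z c -> X (inl (f c)) }.

Lemma amalg_closed_bigcap (S : set (set (A + B))) :
  S `<=` amalg_closed -> amalg_closed [set u | forall X, S X -> X u].
Proof.
move=> SC; split=> /=.
- by move=> u v uv h X SX; exact: (ac_down (SC X SX) uv (h X SX)).
- by move=> a a' h h' X SX; exact: (ac_joinA (SC X SX) (h X SX) (h' X SX)).
- by move=> a a' h h' X SX; exact: (ac_joinB (SC X SX) (h X SX) (h' X SX)).
- by move=> c Zc X SX; exact: (ac_zero (SC X SX) Zc).
Qed.

Definition amalg := closed_lat amalg_closed_bigcap.

Lemma amalg_principal u : amalg_closed [set v | amalg_le v u].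
Proof.
split=> /=.
- by move=> v w vw; exact: amalg_le_trans.
- by move=> a a'; exact: amalg_le_joinA.
- by move=> b b'; exact: amalg_le_joinB.
- move=> c Zc; case: u => [a|b] /=; first by apply: le_modW => //; exact: Zf.
  by exists c; apply: le_modW => //; exact: Zg.
Qed.

Definition amalg_emb u : amalg := exist _ _ (amalg_principal u).

Lemma amalg_embP u (X : amalg) : amalg_emb u <= X <-> mem_closed X u.
Proof.
split=> [/closed_leP|Xu]; first by apply; exact: amalg_le_refl.
by apply/closed_leP => v vu; exact: (ac_down (mem_closedP X) vu Xu).
Qed.

Lemma amalg_emb_eq u v : amalg_emb u = amalg_emb v <-> amalg_le u v /\ amalg_le v u.
Proof.
split=> [uv|[uv vu]].
  split.
    by have /amalg_embP : amalg_emb u <= amalg_emb v by rewrite uv.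
  by have /amalg_embP : amalg_emb v <= amalg_emb u by rewrite uv.
by apply/le_anti/andP; split; apply/amalg_embP.
Qed.

Definition amalgA a := amalg_emb (inl a).
Definition amalgB b := amalg_emb (inr b).

Lemma amalgA_hom : lhom amalgA.
Proof.
split=> x y; apply/esym.
  apply: meet_char; try by apply/amalg_embP; apply: le_modW; rewrite ?leIl ?leIr.
  move=> X /closed_leP Xx /closed_leP Xy; apply/closed_leP => u Xu.
  exact: amalg_le_meetA (Xx u Xu) (Xy u Xu).
apply: join_char; try by apply/amalg_embP; apply: le_modW; rewrite ?leUl ?leUr.
move=> X /amalg_embP Xx /amalg_embP Xy; apply/amalg_embP.
exact: (ac_joinA (mem_closedP X)).
Qed.

Lemma amalgB_hom : lhom amalgB.
Proof.
split=> x y; apply/esym.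
  apply: meet_char; try by apply/amalg_embP; apply: le_modW; rewrite ?leIl ?leIr.
  move=> X /closed_leP Xx /closed_leP Xy; apply/closed_leP => u Xu.
  exact: amalg_le_meetB (Xx u Xu) (Xy u Xu).
apply: join_char; try by apply/amalg_embP; apply: le_modW; rewrite ?leUl ?leUr.
move=> X /amalg_embP Xx /amalg_embP Xy; apply/amalg_embP.
exact: (ac_joinB (mem_closedP X)).
Qed.

Lemma amalg_comm c : amalgA (f c) = amalgB (g c).
Proof. by apply/amalg_emb_eq; split; exists c; apply: le_modW. Qed.

Lemma amalgA_ker a a' : amalgA a = amalgA a' <-> r (a, a').
Proof.
split=> [/amalg_emb_eq[]|raa']; first exact: le_mod_anti.
by apply/amalg_emb_eq; split; apply: le_mod_congr => //; exact: (congr_sym cr).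
Qed.

Lemma amalg_zero c X : Z c -> amalgA (f c) <= X.
Proof. by move=> Zc; apply/amalg_embP; exact: (ac_zero (mem_closedP X)). Qed.

End Amalgam.

(** What a single prime congruence [r] of [A] contributes: a simple lattice in
    which [A] modulo [r] is embedded, together with a compatible image of [B]
    where the relative complements are available. *)
Record host dC dA dB (C : latticeType dC) (A : latticeType dA) (B : latticeType dB)
    (f : C -> A) (g : C -> B) (r : set (A * A)) (Z : set C) := Host {
  hostT : simple_lat;
  hostA : A -> hostT;
  hostB : B -> hostT;
  hostA_hom : lhom hostA;
  hostB_hom : lhom hostB;
  hostA_stop : forall a, hostA a <> stop hostT;
  hostB_stop : forall b, hostB b <> stop hostT;
  host_comm : forall c, hostA (f c) = hostB (g c);
  hostA_ker : forall a a', hostA a = hostA a' <-> r (a, a');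
  host_zero : forall c x, Z c -> hostA (f c) <= x;
  host_compl : forall b1 b2 b3, b1 <= b2 -> b2 <= b3 -> exists x,
    hostB b2 `&` x = hostB b1 /\ hostB b2 `|` x = hostB b3 }.

Lemma host_exists dC dA dB (C : latticeType dC) (A : latticeType dA)
    (B : latticeType dB) (f : C -> A) (g : C -> B) (r : set (A * A)) (Z : set C) :
  lhom f -> lhom g -> congruence setT r ->
  (exists2 s, congruence setT s & restriction g s = restriction f r) ->
  (forall c a, Z c -> f c <= a) -> (forall c b, Z c -> g c <= b) ->
  exists _ : host f g r Z, True.
Proof.
move=> fh gh cr [s cs sr] Zf Zg.
have rs c c' : r (f c, f c') <-> s (g c, g c').
  suff -> : r (f c, f c') = s (g c, g c') by [].
  by have := congr1 (fun q => q (c, c')) sr.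
pose M := amalg f g r s Z; pose o : M := closed_bot _.
have o_le : forall X : M, o <= X by move=> X; exact: closed_bot_le.
pose e (X : M) : spiked_simple_lat (compl_emb_bot o_le) := base (compl_emb o_le X).
have eh : lhom e by exact: lhom_comp (compl_emb_hom o_le) (base_hom _).
have ei : injective e by move=> X Y /base_inj/compl_emb_inj.
have Ah := amalgA_hom fh gh cr cs rs Zf Zg.
have Bh := amalgB_hom fh gh cr cs rs Zf Zg.
unshelve eexists; last by [].
apply: (@Host _ _ _ _ _ _ f g r Z _ _ _ (lhom_comp Ah eh) (lhom_comp Bh eh)) => //=.
- by move=> c; rewrite amalg_comm.
- move=> a a'; split=> [/ei/amalgA_ker //|aa']; congr e; exact/amalgA_ker.
- move=> c x Zc; apply: le_trans (base_bot (compl_emb_bot o_le) x).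
  apply: (lhom_le (base_hom _)); apply: (lhom_le (compl_emb_hom _)).
  exact: amalg_zero.
- move=> b1 b2 b3 b12 b23.
  have [x [x1 x3]] := compl_emb_compl o_le (lhom_le Bh b12) (lhom_le Bh b23).
  have [bI bU] := base_hom (compl_lat o).
  exists (base x); split.
    by rewrite /e -x1; exact/esym/bI.
  by rewrite /e -x3; exact/esym/bU.
Qed.

Definition ext_uniquely d (K : latticeType d) d' (L : latticeType d') (h : K -> L) :=
  forall r, congruence setT r -> exists! s, congruence setT s /\ restriction h s = r.

Section Step.
Variables (dC dA dB : Order.disp_t).
Variables (C : latticeType dC) (A : latticeType dA) (B : latticeType dB).
Variables (f : C -> A) (g : C -> B) (Z : set C).
Hypotheses (fh : lhom f) (gh : lhom g) (finA : congruence_finite [set: A]).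
Hypothesis gext : forall r, congruence [set: C] r ->
  exists2 s, congruence [set: B] s & restriction g s = r.
Hypothesis Zf : forall c a, Z c -> f c <= a.
Hypothesis Zg : forall c b, Z c -> g c <= b.

Let P := {classic {m : set (A * A) | prime_congr m}}.
Let con (p : P) : set (A * A) := sval (p : {m | prime_congr m}).
Let conP p : prime_congr (con p). Proof. exact: svalP. Qed.
Let leP (p q : P) := con p `<=` con q.
Let leP_refl p : leP p p. Proof. by []. Qed.
Let leP_trans p q s : leP p q -> leP q s -> leP p s. Proof. exact: subset_trans. Qed.
Let con_inj p q : con p = con q -> p = q.
Proof. by case: p q => [m mP] [n nP] /= mn; exact: eq_exist. Qed.
Let leP_anti p q : leP p q -> leP q p -> p = q.
Proof. by move=> pq qp; exact/con_inj/seteqP. Qed.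

Let enumP : exists s : seq P, forall p, p \in s.
Proof.
have /finite_seqP[s sE] : finite_set [set: P].
  apply: (finite_transfer finA (f := con)) => [p _|p q _ _]; last exact: con_inj.
  exact: prime_congrP (conP p).
by exists s => p; have : [set: P] p by []; rewrite sE.
Qed.

Let host_ex p : exists _ : host f g (con p) Z, True.
Proof.
apply: host_exists => //; first exact: prime_congrP (conP p).
by apply: gext; apply: congr_preimage => //; exact: prime_congrP (conP p).
Qed.

Let hst p : host f g (con p) Z := proj1_sig (cid (host_ex p)).
Let T p : simple_lat := hostT (hst p).
Let G := glued T leP_trans.

(** A congruence [r] of [A] extends to the congruence of [glued] collapsing the
    primes that do not contain [r]; conversely the down-set of an extension of
    [r] can be recovered from [r], for a prime containing a finite intersection
    of primes contains one of them. *)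
Lemma amalgam_step : exists (G : latticeType cdisp) (h : A -> G) (k : B -> G),
  [/\ lhom h /\ ext_uniquely h, lhom k, forall c, h (f c) = k (g c),
      forall c x, Z c -> h (f c) <= x &
      forall b1 b2 b3, b1 <= b2 -> b2 <= b3 ->
        exists x, k b2 `&` x = k b1 /\ k b2 `|` x = k b3].
Proof.
have [h hh hE] := glued_lift leP_trans
  (fun p => hostA_hom (hst p)) (fun p => @hostA_stop _ _ _ _ _ _ _ _ _ _ (hst p)).
have [k kh kE] := glued_lift leP_trans
  (fun p => hostB_hom (hst p)) (fun p => @hostB_stop _ _ _ _ _ _ _ _ _ _ (hst p)).
exists G, h, k; split=> //.
- split=> // r cr; pose X : set P := [set p | ~ (r `<=` con p)].
  have Xdown : down_closed leP X.
    by move=> p q pq Xq rp; apply: Xq; exact: subset_trans pq.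
  exists (agree X); split; first split.
  + exact: agree_congr.
  + apply/seteqP; split=> [[a a'] /= aa'|[a a'] raa' p /=].
      apply: contrapT => nr; have [m [pm rm mn]] := prime_separates finA cr nr.
      pose p : P := exist _ m pm.
      have /aa' : ~ X p by apply.
      by rewrite !hE /= => /hostA_ker.
    by move=> /contrapT rp; rewrite !hE; apply/hostA_ker; exact: rp.
  + move=> s [cs srE]; have [enum enumPP] := enumP.
    have [Ydown ->] := glued_congr leP_refl leP_anti enumPP cs.
    set Y := collapsed s.
    have rE : r = [set q | forall p, ~ Y p -> con p q].
      rewrite -srE (glued_congr leP_refl leP_anti enumPP cs).2.
      apply/seteqP; split=> [[a a'] /= aa' p Yp|[a a'] /= aa' p Yp].
        by have := aa' p Yp; rewrite !hE => /hostA_ker.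
      by rewrite /= !hE; apply/hostA_ker; exact: aa'.
    congr agree; apply/seteqP; split=> p /=; last first.
      move=> Yp rp.
      have [_ [q nYq <-] qp] : exists2 m, [set con q | q in ~` Y] m & m `<=` con p.
        apply: prime_bigcap => // [_ [q _ <-]|a all_a]; first exact: prime_congrP (conP q).
        by apply: rp; rewrite rE /= => q nYq; apply: all_a; exists q.
      by apply: nYq; exact: Ydown qp Yp.
    move=> nrp; apply: contrapT => nYp; apply: nrp => a.
    by rewrite rE => /(_ p nYp).
- by move=> c; apply: glued_ext => p; rewrite hE kE; exact: host_comm.
- by move=> c x Zc; apply/glued_leP => p; rewrite hE; exact: host_zero.
- move=> b1 b2 b3 b12 b23.
  have ex p := host_compl (hst p) b12 b23.
  pose y p := proj1_sig (cid (ex p)).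
  have yI p : hostB (hst p) b2 `&` y p = hostB (hst p) b1 by rewrite /y; case: cid => ? [].
  have yU p : hostB (hst p) b2 `|` y p = hostB (hst p) b3 by rewrite /y; case: cid => ? [].
  have ys p : y p <> stop (T p).
    move=> yp; apply: (@hostB_stop _ _ _ _ _ _ _ _ _ _ (hst p) b3).
    by apply/le_anti; rewrite le_stop -yU -{1}yp leUr.
  have [|x xE] := @glued_exists _ _ T leP_trans y; first by move=> p q _ /ys.
  exists x; split; apply: glued_ext => p; first by rewrite coord_meet !kE xE; exact: yI.
  rewrite coord_join_out; first by rewrite !kE xE; exact: yU.
  move=> [q _]; rewrite kE xE yU; exact: hostB_stop.
Qed.

End Step.

(** * Direct limits *)

(** The partially ordered quotient of a quasi-ordered set, each class being
    represented by the set of elements below it. *)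
Section Quotient.
Variables (T : Type) (le : T -> T -> Prop).
Hypothesis le_refl : forall x, le x x.
Hypothesis le_trans : forall x y z, le x y -> le y z -> le x z.
Hypothesis inf_ex : forall x y, exists m, forall z, le z m <-> le z x /\ le z y.
Hypothesis sup_ex : forall x y, exists j, forall z, le j z <-> le x z /\ le y z.

Let down x : set T := [set y | le y x].
Let quot := {D : set T | exists x, D = down x}.
Let qle (X Y : quot) := sval X `<=` sval Y.
Let qcls x : quot := exist _ (down x) (ex_intro _ x erefl).

Let qcls_le x y : qle (qcls x) (qcls y) <-> le x y.
Proof. by split=> [|xy z /= zx]; [apply; exact: le_refl|exact: le_trans xy]. Qed.

Let qcls_surj X : exists x, X = qcls x.
Proof. by case: X => D [x Dx]; exists x; exact: eq_exist. Qed.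

Let qle_anti X Y : qle X Y -> qle Y X -> X = Y.
Proof. by case: X Y => [X hX] [Y hY] XY YX; exact/eq_exist/seteqP. Qed.

Let qinf_ex X Y : exists m, forall Z, qle Z m <-> qle Z X /\ qle Z Y.
Proof.
have [x ->] := qcls_surj X; have [y ->] := qcls_surj Y; have [m mP] := inf_ex x y.
by exists (qcls m) => Z; have [z ->] := qcls_surj Z; rewrite !qcls_le.
Qed.

Let qsup_ex X Y : exists j, forall Z, qle j Z <-> qle X Z /\ qle Y Z.
Proof.
have [x ->] := qcls_surj X; have [y ->] := qcls_surj Y; have [j jP] := sup_ex x y.
by exists (qcls j) => Z; have [z ->] := qcls_surj Z; rewrite !qcls_le.
Qed.

Definition quot_data : lat_data :=
  @LatData quot qle (fun X => @subset_refl _ _) qle_anti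
    (fun X Y Z => @subset_trans _ _ _ _) qinf_ex qsup_ex.
Definition quot_lat : latticeType cdisp := lat_of quot_data.

Definition cls x : quot_lat := qcls x.

Lemma cls_le x y : cls x <= cls y <-> le x y.
Proof. by split=> [/latP/qcls_le|xy] //; apply/latP/qcls_le. Qed.

Lemma cls_surj X : exists x, X = cls x.
Proof. exact: qcls_surj. Qed.

Lemma cls_meet x y m : (forall z, le z m <-> le z x /\ le z y) -> cls x `&` cls y = cls m.
Proof.
move=> mP; have [mx my] := (mP m).1 (le_refl m).
apply: meet_char; [exact/cls_le|exact/cls_le|] => Z.
by have [z ->] := cls_surj Z => /cls_le ? /cls_le ?; exact/cls_le/mP.
Qed.

Lemma cls_join x y j : (forall z, le j z <-> le x z /\ le y z) -> cls x `|` cls y = cls j.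
Proof.
move=> jP; have [xj yj] := (jP j).1 (le_refl j).
apply: join_char; [exact/cls_le|exact/cls_le|] => Z.
by have [z ->] := cls_surj Z => /cls_le ? /cls_le ?; exact/cls_le/jP.
Qed.

End Quotient.

(** An element of the direct limit is represented by a sequence that is defined
    from some index on and follows the transition maps.  With undefined initial
    values no transport between the types [L n] is ever needed. *)
Definition is_thread (L : nat -> Type) (k : forall n, L n -> L n.+1)
    (t : forall n, option (L n)) :=
  forall n x, t n = Some x -> t n.+1 = Some (k n x).

(** By induction on [n], for all sequences at once: the step drops the first
    lattice of the sequence. *)
Lemma thread_from n : forall (L : nat -> Type) (k : forall n, L n -> L n.+1) (x : L n),
  exists t, is_thread k t /\ t n = Some x.
Proof.
elim: n => [|n IH] L k x.
  pose t := nat_rect L x k.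
  by exists (fun m => Some (t m)); split=> // m _ [<-].
have [t [tt tn]] := IH (fun m => L m.+1) (fun m => k m.+1) x.
exists (fun m => match m with 0 => None | m'.+1 => t m' end); split=> //.
by case=> [|m] y //; exact: tt.
Qed.

Section Limit.
Variables (L : nat -> latticeType cdisp) (k : forall n, L n -> L n.+1).
Hypothesis kh : forall n, lhom (@k n).

Let thread := {t | is_thread k t /\ exists n x, t n = Some x}.
Let mk t (tt : is_thread k t) (tp : exists n x, t n = Some x) : thread :=
  exist _ t (conj tt tp).
Let at_ (t : thread) n : option (L n) := sval t n.

Let at_S (t : thread) n x : at_ t n = Some x -> at_ t n.+1 = Some (k x).
Proof. exact: (svalP t).1. Qed.

Let at_ge (t : thread) n m x : at_ t n = Some x -> (n <= m)%N -> exists y, at_ t m = Some y.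
Proof.
move=> tn; elim: m => [|m IH]; first by rewrite leqn0 => /eqP <-; exists x.
rewrite leq_eqVlt => /orP[/eqP <-|]; first by exists x.
by rewrite ltnS => /IH[y tm]; exists (k y); exact: at_S.
Qed.

Let at_pt (t : thread) : exists n x, at_ t n = Some x.
Proof. exact: (svalP t).2. Qed.

(** Whatever the transition maps preserve spreads to all later indices. *)
Let persist (R : forall n, L n -> L n -> Prop) :
  (forall n x y, R n x y -> R n.+1 (k x) (k y)) ->
  forall (t u : thread) n m x y, at_ t n = Some x -> at_ u n = Some y -> R n x y ->
  (n <= m)%N -> exists x' y', [/\ at_ t m = Some x', at_ u m = Some y' & R m x' y'].
Proof.
move=> RS t u n m x y tn un Rn; elim: m => [|m IH].
  by rewrite leqn0 => /eqP <-; exists x, y.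
rewrite leq_eqVlt => /orP[/eqP <-|]; first by exists x, y.
rewrite ltnS => /IH[x' [y' [tm um Rm]]].
by exists (k x'), (k y'); split; [exact: at_S|exact: at_S|exact: RS].
Qed.

Let tle (t u : thread) := exists n x y, [/\ at_ t n = Some x, at_ u n = Some y & x <= y].

Let tle_up (t u : thread) : tle t u -> exists N, forall n, (N <= n)%N ->
  exists x y, [/\ at_ t n = Some x, at_ u n = Some y & x <= y].
Proof.
move=> [N [x [y [tN uN xy]]]]; exists N => n.
apply: (persist (R := fun n x y => x <= y)) tN uN xy => {}n {}x {}y.
exact: lhom_le.
Qed.

Let tle_refl t : tle t t.
Proof. by have [n [x tn]] := at_pt t; exists n, x, x. Qed.

Let tle_trans t u v : tle t u -> tle u v -> tle t v.
Proof.
move=> /tle_up[N hN] /tle_up[M hM]; pose n := maxn N M.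
have [x [y [tn un xy]]] := hN n (leq_maxl _ _).
have [y' [z [un' vn yz]]] := hM n (leq_maxr _ _).
exists n, x, z; split=> //; apply: (le_trans xy).
by move: un'; rewrite un => -[->].
Qed.

Let op2 (op : forall n, L n -> L n -> L n) (t u : forall n, option (L n)) n :=
  match t n, u n with Some x, Some y => Some (op n x y) | _, _ => None end.

Let op_ex (op : forall n, L n -> L n -> L n) :
  (forall n x y, k (op n x y) = op n.+1 (k x) (k y)) ->
  forall t u : thread, exists v : thread, forall n x y,
    at_ t n = Some x -> at_ u n = Some y -> at_ v n = Some (op n x y).
Proof.
move=> kop t u.
have vt : is_thread k (op2 op (at_ t) (at_ u)).
  move=> n z; rewrite /op2; case tn: (at_ t n) => [x|//]; case un: (at_ u n) => [y|//] [<-].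
  by rewrite (at_S tn) (at_S un) kop.
have vp : exists n x, op2 op (at_ t) (at_ u) n = Some x.
  have [n [x tn]] := at_pt t; have [m [y um]] := at_pt u.
  have [x' tx'] := at_ge tn (leq_maxl n m); have [y' ty'] := at_ge um (leq_maxr n m).
  by exists (maxn n m), (op _ x' y'); rewrite /op2 tx' ty'.
exists (mk vt vp) => n x y tn un.
rewrite -[at_ _ _]/(op2 op (at_ t) (at_ u) n).
by rewrite /op2 tn un.
Qed.

Let meet_ex (t u : thread) : exists m : thread,
  (forall n x y, at_ t n = Some x -> at_ u n = Some y -> at_ m n = Some (x `&` y)) /\
  (forall z, tle z m <-> tle z t /\ tle z u).
Proof.
have [m mE] := op_ex (op := fun n x y => x `&` y) (fun n => (kh n).1) t u.
exists m; split=> // z.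
have [nt [x0 tx0]] := at_pt t; have [nu [y0 uy0]] := at_pt u; split.
  move=> /tle_up[N hN]; pose n := maxn N (maxn nt nu).
  have [x tx] := at_ge tx0 (leq_trans (leq_maxl nt nu) (leq_maxr N _)).
  have [y uy] := at_ge uy0 (leq_trans (leq_maxr nt nu) (leq_maxr N _)).
  have [w [v [zw mv wv]]] := hN n (leq_maxl _ _).
  move: mv wv; rewrite (mE n x y) // => -[<-]; rewrite lexI => /andP[wx wy].
  by split; [exists n, w, x|exists n, w, y].
move=> [/tle_up[N hN] /tle_up[M hM]]; pose n := maxn N M.
have [w [x [zw tx wx]]] := hN n (leq_maxl _ _).
have [w' [y [zw' uy wy]]] := hM n (leq_maxr _ _).
exists n, w, (x `&` y); split=> //; first exact: mE.
by rewrite lexI wx; move: zw'; rewrite zw => -[->].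
Qed.

Let join_ex (t u : thread) : exists m : thread,
  (forall n x y, at_ t n = Some x -> at_ u n = Some y -> at_ m n = Some (x `|` y)) /\
  (forall z, tle m z <-> tle t z /\ tle u z).
Proof.
have [m mE] := op_ex (op := fun n x y => x `|` y) (fun n => (kh n).2) t u.
exists m; split=> // z.
have [nt [x0 tx0]] := at_pt t; have [nu [y0 uy0]] := at_pt u; split.
  move=> /tle_up[N hN]; pose n := maxn N (maxn nt nu).
  have [x tx] := at_ge tx0 (leq_trans (leq_maxl nt nu) (leq_maxr N _)).
  have [y uy] := at_ge uy0 (leq_trans (leq_maxr nt nu) (leq_maxr N _)).
  have [v [w [mv zw vw]]] := hN n (leq_maxl _ _).
  move: mv vw; rewrite (mE n x y) // => -[<-]; rewrite leUx => /andP[wx wy].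
  by split; [exists n, x, w|exists n, y, w].
move=> [/tle_up[N hN] /tle_up[M hM]]; pose n := maxn N M.
have [x [w [tx zw wx]]] := hN n (leq_maxl _ _).
have [y [w' [uy zw' wy]]] := hM n (leq_maxr _ _).
exists n, (x `|` y), w; split=> //; first exact: mE.
by rewrite leUx wx; move: wy; move: zw'; rewrite zw => -[->].
Qed.

Definition limit : latticeType cdisp :=
  quot_lat tle_refl tle_trans
    (fun t u => let: ex_intro m (conj _ mP) := meet_ex t u in ex_intro _ m mP)
    (fun t u => let: ex_intro j (conj _ jP) := join_ex t u in ex_intro _ j jP).

Let thr_ex n (x : L n) : exists t : thread, at_ t n = Some x.
Proof.
have [t [tt tn]] := thread_from k x.
by exists (mk tt (ex_intro _ n (ex_intro _ x tn))).
Qed.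

Let thr n (x : L n) : thread := sval (cid (thr_ex x)).
Let thrP n (x : L n) : at_ (thr x) n = Some x.
Proof. by rewrite /thr; case: cid. Qed.

Definition inj_lim n (x : L n) : limit := cls _ _ _ _ (thr x).

Let cls_at (t u : thread) n x : at_ t n = Some x -> at_ u n = Some x ->
  cls tle_refl tle_trans _ _ t = cls _ _ _ _ u :> limit.
Proof.
by move=> tn un; apply/le_anti/andP; split; apply/cls_le; exists n, x, x.
Qed.

Lemma inj_lim_hom n : lhom (@inj_lim n).
Proof.
split=> x y; rewrite /inj_lim.
  have [m [mE mP]] := meet_ex (thr x) (thr y); rewrite (cls_meet _ _ _ _ mP).
  by apply: (cls_at (thrP _)); apply: mE; exact: thrP.
have [m [mE mP]] := join_ex (thr x) (thr y); rewrite (cls_join _ _ _ _ mP).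
by apply: (cls_at (thrP _)); apply: mE; exact: thrP.
Qed.

Lemma inj_limS n (x : L n) : inj_lim (k x) = inj_lim x.
Proof. by apply: (cls_at (thrP _)); apply: at_S; exact: thrP. Qed.

Lemma inj_lim_rep z : exists N, forall n, (N <= n)%N -> exists x : L n, inj_lim x = z.
Proof.
have [t ->] := cls_surj z; have [N [x tN]] := at_pt t; exists N => n /(at_ge tN)[y tn].
by exists y; apply: (cls_at (thrP _)) tn.
Qed.

Section LimitCongruence.
Variable s : forall n, set (L n * L n).
Hypothesis cs : forall n, congruence setT (@s n).
Hypothesis sS : forall n, restriction (@k n) (@s n.+1) = @s n.

Let sSE n x y : @s n (x, y) = @s n.+1 (k x, k y).
Proof. by rewrite -sS. Qed.

(** Equal elements of the limit have representatives that merge at a later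
    index, and [s] is both preserved and reflected along the way. *)
Let s_inv n m (x y : L n) (x' y' : L m) :
  inj_lim x = inj_lim x' -> inj_lim y = inj_lim y' -> @s n (x, y) -> @s m (x', y').
Proof.
have meetup a b (u : L a) (v : L b) : inj_lim u = inj_lim v ->
    exists N, forall j, (N <= j)%N -> exists w, at_ (thr u) j = Some w /\ at_ (thr v) j = Some w.
  move=> uv.
  have /cls_le/tle_up[N hN] : inj_lim u <= inj_lim v by rewrite uv.
  have /cls_le/tle_up[M hM] : inj_lim v <= inj_lim u by rewrite uv.
  exists (maxn N M) => j; rewrite geq_max => /andP[/hN[p [q [up vq pq]]] /hM[q' [p' []]]].
  rewrite up vq => -[<-] [<-] qp; exists p; split=> //; congr Some.
  by apply/le_anti; rewrite qp.
move=> /meetup[N hN] /meetup[M hM] sxy; pose j := maxn (maxn N M) (maxn n m).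
have [p [xp x'p]] := hN j (leq_trans (leq_maxl N M) (leq_maxl _ _)).
have [q [yq y'q]] := hM j (leq_trans (leq_maxr N M) (leq_maxl _ _)).
have spq : @s j (p, q).
  have [|p' [q' []]] := persist (R := fun i u v => @s i (u, v)) _ (thrP x) (thrP y) sxy
    (leq_trans (leq_maxl n m) (leq_maxr (maxn N M) _)).
    by move=> i u v; rewrite sSE.
  by rewrite xp yq => -[->] [->].
apply: contrapT => nxy.
have [|p' [q' []]] := persist (R := fun i u v => ~ @s i (u, v)) _ (thrP x') (thrP y') nxy
    (leq_trans (leq_maxr n m) (leq_maxr (maxn N M) _)).
  by move=> i u v; rewrite sSE.
by rewrite x'p y'q => -[<-] [<-].
Qed.

Lemma limit_congr : exists2 S, congruence [set: limit] S &
  forall n, restriction (@inj_lim n) S = @s n.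
Proof.
pose S : set (limit * limit) := [set z | exists n (x y : L n),
  [/\ inj_lim x = z.1, inj_lim y = z.2 & @s n (x, y)]].
have SE n (x y : L n) : S (inj_lim x, inj_lim y) <-> @s n (x, y).
  split=> [[m [x' [y' [/= xx yy sxy]]]]|sxy]; last by exists n, x, y.
  exact: s_inv sxy.
have S_raise z z' : S (z, z') -> exists N, forall n, (N <= n)%N ->
    exists x y : L n, [/\ inj_lim x = z, inj_lim y = z' & @s n (x, y)].
  move=> Szz; have [N hN] := inj_lim_rep z; have [M hM] := inj_lim_rep z'.
  exists (maxn N M) => n; rewrite geq_max => /andP[/hN[x xz] /hM[y yz]].
  by exists x, y; split=> //; apply/SE; rewrite xz yz.
have S2 a a' b b' : S (a, a') -> S (b, b') -> exists n (x x' y y' : L n),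
    [/\ [/\ inj_lim x = a, inj_lim x' = a', inj_lim y = b & inj_lim y' = b'],
        @s n (x, x') & @s n (y, y')].
  move=> /S_raise[N hN] /S_raise[M hM].
  have [x [x' [xa xa' sxx]]] := hN _ (leq_maxl N M).
  have [y [y' [yb yb' syy]]] := hM _ (leq_maxr N M).
  by exists (maxn N M), x, x', y, y'.
exists S; last by move=> n; apply/seteqP; split=> -[x y] /SE.
split=> //.
- move=> z _; have [N /(_ N (leqnn N))[x <-]] := inj_lim_rep z.
  by apply/SE; exact: (congr_refl (cs N)).
- by move=> a b [n [x [y /= [<- <- /(congr_sym (cs n)) syx]]]]; apply/SE.
- move=> a b c ab bc; have [n [x [y [y' [z [[<- yb yb' <-] sxy syz]]]]]] := S2 _ _ _ _ ab bc.
  apply/SE; apply: (congr_trans (cs n) sxy); apply: s_inv syz => //.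
  by rewrite yb yb'.
- move=> a a' b b' aa bb.
  have [n [x [x' [y [y' [[<- <- <- <-] sxx syy]]]]]] := S2 _ _ _ _ aa bb.
  by rewrite -!(inj_lim_hom n).1; apply/SE; exact: (congr_meet (cs n)).
- move=> a a' b b' aa bb.
  have [n [x [x' [y [y' [[<- <- <- <-] sxx syy]]]]]] := S2 _ _ _ _ aa bb.
  by rewrite -!(inj_lim_hom n).2; apply/SE; exact: (congr_join (cs n)).
Qed.

End LimitCongruence.

End Limit.

(** * Sublattices as lattices *)

Section Sublattice.
Variables (d : Order.disp_t) (K : latticeType d) (F : set K).
Hypothesis sF : sublattice F.

Let sub := {x | F x}.
Let le (x y : sub) : Prop := sval x <= sval y.

Let sub_anti x y : le x y -> le y x -> x = y.
Proof.
by case: x y => [x Fx] [y Fy] xy yx; apply: eq_exist; apply/le_anti/andP.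
Qed.

Let sub_trans x y z : le x y -> le y z -> le x z.
Proof. exact: le_trans. Qed.

Let sub_inf x y : exists m, forall z, le z m <-> le z x /\ le z y.
Proof.
exists (exist _ _ (sF (svalP x) (svalP y)).1) => z.
by rewrite /le /= lexI; split=> /andP.
Qed.

Let sub_sup x y : exists j, forall z, le j z <-> le x z /\ le y z.
Proof.
exists (exist _ _ (sF (svalP x) (svalP y)).2) => z.
by rewrite /le /= leUx; split=> /andP.
Qed.

Definition sub_data : lat_data :=
  @LatData sub le (fun x => lexx _) sub_anti sub_trans sub_inf sub_sup.
Definition sub_lat : latticeType cdisp := lat_of sub_data.

Definition sub_val (x : sub_lat) : K := sval (x : sub).

Lemma sub_val_mem x : F (sub_val x).
Proof. exact: (svalP (x : sub)). Qed.

Lemma sub_val_inj : injective sub_val.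
Proof. by move=> [x Fx] [y Fy] /= xy; exact: eq_exist. Qed.

Lemma sub_exists x : F x -> exists y, sub_val y = x.
Proof. by move=> Fx; exists (exist _ x Fx). Qed.

Lemma sub_leP (x y : sub_lat) : x <= y <-> sub_val x <= sub_val y.
Proof. exact: latP. Qed.

Lemma sub_val_hom : lhom sub_val.
Proof.
have [I U] : (forall x y, F (sub_val x `&` sub_val y)) /\
    (forall x y, F (sub_val x `|` sub_val y)).
  by split=> x y; [apply: (sF _ _).1|apply: (sF _ _).2]; exact: sub_val_mem.
split=> x y.
  have [m mE] := sub_exists (I x y); rewrite -mE; congr sub_val.
  apply: meet_char; try by apply/sub_leP; rewrite mE ?leIl ?leIr.
  by move=> z /sub_leP zx /sub_leP zy; apply/sub_leP; rewrite mE lexI zx.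
have [j jE] := sub_exists (U x y); rewrite -jE; congr sub_val.
apply: join_char; try by apply/sub_leP; rewrite jE ?leUl ?leUr.
by move=> z /sub_leP xz /sub_leP yz; apply/sub_leP; rewrite jE leUx xz.
Qed.

Lemma sub_congruence_finite : congruence_finite F -> congruence_finite [set: sub_lat].
Proof.
move=> finF; pose ext (r : set (sub_lat * sub_lat)) : set (K * K) :=
  [set p | exists x y, [/\ sub_val x = p.1, sub_val y = p.2 & r (x, y)]].
have extE r x y : ext r (sub_val x, sub_val y) <-> r (x, y).
  split=> [[x' [y' [/= /sub_val_inj -> /sub_val_inj -> //]]]|rxy].
  by exists x, y.
apply: (finite_transfer finF (f := ext)) => [r cr|r r' _ _ rr]; last first.
  by apply/seteqP; split=> -[x y] rxy; apply/extE; [rewrite -rr|rewrite rr]; apply/extE.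
split.
- by move=> [a b] [x [y [/= <- <- _]]]; split; exact: sub_val_mem.
- by move=> x /sub_exists[y <-]; apply/extE; exact: (congr_refl cr).
- move=> a b [x [y [/= <- <- rxy]]]; apply/extE; exact: (congr_sym cr).
- move=> a b c [x [y [/= <- <- rxy]]] [y' [z [/= /sub_val_inj -> <- ryz]]].
  by apply/extE; exact: (congr_trans cr rxy).
- move=> a b a' b' [x [y [/= <- <- rxy]]] [x' [y' [/= <- <- rxy']]].
  by rewrite -!sub_val_hom.1; apply/extE; exact: (congr_meet cr).
- move=> a b a' b' [x [y [/= <- <- rxy]]] [x' [y' [/= <- <- rxy']]].
  by rewrite -!sub_val_hom.2; apply/extE; exact: (congr_join cr).
Qed.

End Sublattice.

(** Restriction is injective on congruences, by uniqueness of extensions. *)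
Lemma ext_uniquely_finite d (K : latticeType d) d' (L : latticeType d') (h : K -> L) :
  lhom h -> ext_uniquely h -> congruence_finite [set: K] -> congruence_finite [set: L].
Proof.
move=> hh eh finK; apply: (finite_transfer finK (f := restriction h)) => [s cs|s s' cs cs' ss].
  exact: congr_preimage.
have [t [_ tu]] := eh _ (congr_preimage hh cs).
by rewrite -(tu s) // -(tu s').
Qed.

Lemma range_congruence_finite d (K : latticeType d) d' (L : latticeType d') (h : K -> L) :
  lhom h -> congruence_finite [set: K] -> congruence_finite (range h).
Proof.
move=> [hI hU] finK.
apply: (finite_transfer finK (f := restriction h)) => [s [ss sr sy st sI sU]|s s' cs cs' ss].
  split=> //.
  - by move=> x _; apply: sr; exists x.
  - by move=> x y; exact: sy.
  - by move=> x y z; exact: st.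
  - by move=> x1 y1 x2 y2; rewrite /restriction /= !hI; exact: sI.
  - by move=> x1 y1 x2 y2; rewrite /restriction /= !hU; exact: sU.
have sub t t' : congruence (range h) t -> restriction h t = restriction h t' -> t `<=` t'.
  move=> ct tt [a b] tab; have [[x _ /= xa] [y _ /= yb]] := congr_sub ct tab.
  have : restriction h t (x, y) by rewrite /restriction /= xa yb.
  by rewrite tt /restriction /= xa yb.
by apply/seteqP; split; exact: sub.
Qed.

Lemma lmorphism_exists d (K : latticeType d) d' (L : latticeType d') (h : K -> L) :
  lhom h -> exists f : {lmorphism K -> L}, f = h :> (K -> L).
Proof.
move=> hh.
pose m1 := Order.isOrderMorphism.Build d K d' L h (lhom_le hh).
pose m2 := Order.isMeetLatticeMorphism.Build d K d' L h hh.1.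
pose m3 := Order.isJoinLatticeMorphism.Build d K d' L h hh.2.
pose f : {lmorphism K -> L} := HB.pack h m1 m2 m3.
by exists f.
Qed.

(** * The tower *)

Section Tower.
Variables (d : Order.disp_t) (K : latticeType d) (F : nat -> set K).
Hypotheses (sF : forall n, sublattice (F n)) (finF : forall n, congruence_finite (F n)).
Hypotheses (FS : forall n, F n `<=` F n.+1) (Fcover : \bigcup_n F n = [set: K]).
Hypothesis F0 : forall z, is_zero z -> F 0 z.

Let Kn n : latticeType cdisp := sub_lat (@sF n).
Let val n (x : Kn n) : K := sub_val x.

Let F_le n m : (n <= m)%N -> F n `<=` F m.
Proof.
elim: m => [|m IH]; first by rewrite leqn0 => /eqP ->.
rewrite leq_eqVlt => /orP[/eqP -> //|]; rewrite ltnS => /IH nm.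
exact: subset_trans (@FS m).
Qed.

Let incl_ex n (x : Kn n) : exists y : Kn n.+1, val y = val x.
Proof. by apply: sub_exists; apply: FS; exact: sub_val_mem. Qed.

Let incl n (x : Kn n) : Kn n.+1 := sval (cid (incl_ex x)).
Let val_incl n (x : Kn n) : val (incl x) = val x.
Proof. by rewrite /incl; case: cid. Qed.

Let incl_hom n : lhom (@incl n).
Proof.
split=> x y; apply: (@sub_val_inj _ _ _ (@sF n.+1)); rewrite [LHS]val_incl.
  by rewrite (sub_val_hom (@sF n.+1)).1 -!/(val _) !val_incl /val (sub_val_hom (@sF n)).1.
by rewrite (sub_val_hom (@sF n.+1)).2 -!/(val _) !val_incl /val (sub_val_hom (@sF n)).2.
Qed.

Record stage n := Stage {
  slev :> latticeType cdisp;
  semb : Kn n -> slev;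
  semb_hom : lhom semb;
  semb_ext : ext_uniquely semb;
  semb_zero : forall c x, is_zero (val c) -> semb c <= x }.

Let stage0 : stage 0.
Proof.
apply: (@Stage 0 (Kn 0) id) => //.
- move=> r cr; exists r; split; first by split=> //; apply/seteqP; split=> -[].
  by move=> s [_ <-]; apply/seteqP; split=> -[].
- by move=> c x cz; apply/sub_leP; exact: cz.
Qed.

Let next_spec n (s : stage n) (u : stage n.+1) (k : s -> u) :=
  [/\ lhom k, forall c, semb u (incl c) = k (semb s c) &
    forall b1 b2 b3, b1 <= b2 -> b2 <= b3 ->
      exists x, k b2 `&` x = k b1 /\ k b2 `|` x = k b3].

Let next_ex n (s : stage n) : exists u : stage n.+1, exists k : s -> u, next_spec k.
Proof.
have finA := sub_congruence_finite (@sF n.+1) (@finF n.+1).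
have gext r : congruence [set: Kn n] r ->
    exists2 t, congruence [set: s] t & restriction (semb s) t = r.
  by move=> cr; have [t [[ct tr] _]] := semb_ext s cr; exists t.
pose Z : set (Kn n) := [set c | is_zero (val c)].
have Zf c a : Z c -> incl c <= a.
  by move=> cz; apply/sub_leP; rewrite -/(val _) val_incl; exact: cz.
have Zg c b : Z c -> semb s c <= b by move=> cz; exact: semb_zero.
have [G [h [k [[hh eh] kh hk hz kc]]]] :=
  amalgam_step (incl_hom n) (semb_hom s) finA gext Zf Zg.
have uz c x : is_zero (val c) -> h c <= x.
  move=> cz; have [c' c'c] := sub_exists (@sF n) (F_le (leq0n n) (F0 cz)).
  have -> : c = incl c' by apply: sub_val_inj; rewrite -/(val _) -/(val _) val_incl.
  by apply: hz; rewrite /Z /= /val c'c.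
by exists (Stage hh eh uz), k.
Qed.

Let next n (s : stage n) : stage n.+1 := sval (cid (next_ex s)).
Let knext n (s : stage n) : s -> next s := sval (cid (svalP (cid (next_ex s)))).
Let knextP n (s : stage n) : next_spec (@knext n s).
Proof. exact: (svalP (cid (svalP (cid (next_ex s))))). Qed.

Let tower n : stage n := nat_rect stage stage0 next n.
Let L n : latticeType cdisp := tower n.
Let k n : L n -> L n.+1 := @knext n (tower n).
Let e n : Kn n -> L n := semb (tower n).

Let eh n : lhom (@e n) := semb_hom (tower n).
Let kh n : lhom (@k n).
Proof. by have [h _ _] := knextP (tower n); exact: h. Qed.

Let ke n c : e (incl c) = k (@e n c).
Proof. by have [_ h _] := knextP (tower n); exact: h. Qed.

Let Lim := limit kh.
Let iota n : L n -> Lim := @inj_lim _ _ kh n.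
Let iotah n : lhom (@iota n) := inj_lim_hom kh n.

Let iota_e_le n m (x : Kn n) (y : Kn m) : (n <= m)%N -> val x = val y ->
  iota (e x) = iota (e y).
Proof.
elim: m y => [|m IH] y.
  rewrite leqn0 => /eqP n0; subst n => xy; congr (iota (e _)).
  exact: sub_val_inj xy.
rewrite leq_eqVlt => /orP[/eqP nm|]; first by subst n => /sub_val_inj ->.
rewrite ltnS => nm xy.
have [z zx] := sub_exists (@sF m) (F_le nm (sub_val_mem x)).
rewrite (IH z) //.
have -> : y = incl z by apply: sub_val_inj; rewrite -/(val _) -/(val _) val_incl -xy.
by rewrite ke; exact/esym/inj_limS.
Qed.

Let iota_e n m (x : Kn n) (y : Kn m) : val x = val y -> iota (e x) = iota (e y).
Proof.
by move=> xy; case/orP: (leq_total n m) => nm; [|apply/esym]; apply: iota_e_le.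
Qed.

Let rep (x : K) : exists N, forall n, (N <= n)%N -> exists y : Kn n, val y = x.
Proof.
have : [set: K] x by [].
rewrite -Fcover => -[N _ FNx]; exists N => n Nn.
by apply: sub_exists; exact: F_le FNx.
Qed.

Let phi_ex (x : K) : exists z : Lim, forall n (y : Kn n), val y = x -> iota (e y) = z.
Proof.
have [N /(_ N (leqnn N))[y yx]] := rep x.
by exists (iota (e y)) => n y' y'x; apply: iota_e; rewrite y'x.
Qed.

Let phi (x : K) : Lim := sval (cid (phi_ex x)).
Let phiE n (y : Kn n) : phi (val y) = iota (e y).
Proof. by rewrite /phi; case: cid => z /= /(_ n y) ->. Qed.

Let rep2 (x y : K) : exists n (a b : Kn n), val a = x /\ val b = y.
Proof.
have [N hN] := rep x; have [M hM] := rep y.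
have [a ax] := hN _ (leq_maxl N M); have [b bx] := hM _ (leq_maxr N M).
by exists (maxn N M), a, b.
Qed.

Let phi_hom : lhom phi.
Proof.
split=> x y; have [n [a [b [<- <-]]]] := rep2 x y.
  by rewrite -(sub_val_hom (@sF n)).1 !phiE (eh n).1 (iotah n).1.
by rewrite -(sub_val_hom (@sF n)).2 !phiE (eh n).2 (iotah n).2.
Qed.

Let lim_rep2 (x y : Lim) : exists n (a b : L n), iota a = x /\ iota b = y.
Proof.
have [N hN] := inj_lim_rep x; have [M hM] := inj_lim_rep y.
have [a ax] := hN _ (leq_maxl N M); have [b bx] := hM _ (leq_maxr N M).
by exists (maxn N M), a, b.
Qed.

(** The traces of [r] on the [K_n] have unique extensions to the [L_n]; by
    uniqueness these are compatible, and so they glue to a congruence of the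
    limit. *)
Let phi_ext : ext_uniquely phi.
Proof.
move=> r cr; pose rn n := restriction (@val n) r.
have crn n : congruence setT (rn n) by exact: congr_preimage (sub_val_hom (@sF n)) cr.
pose s n := sval (cid (semb_ext (tower n) (crn n))).
have [cs se su] : [/\ forall n, congruence setT (s n),
    forall n, restriction (@e n) (s n) = rn n &
    forall n t, congruence setT t -> restriction (@e n) t = rn n -> s n = t].
  split=> n; rewrite /s; case: cid => t /= [[ct te] tu] //.
  by move=> t' ct' te'; apply: tu.
have sS n : restriction (@k n) (s n.+1) = s n.
  apply/esym/su; first exact: (congr_preimage (@kh n) (cs n.+1)).
  apply/seteqP; split=> -[x y]; rewrite /restriction /= -!ke.
    move=> h; have : rn n.+1 (incl x, incl y) by rewrite -se.
    by rewrite /rn /restriction /= !val_incl.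
  move=> h; have : rn n.+1 (incl x, incl y) by rewrite /rn /restriction /= !val_incl.
  by rewrite -se.
have [S cS SE] := limit_congr kh cs sS.
have phi_S t : (forall n, restriction (@iota n) t = s n) -> restriction phi t = r.
  move=> tE; have tiff n (a b : Kn n) : t (iota (e a), iota (e b)) = r (val a, val b).
    transitivity (restriction (@iota n) t (e a, e b)); first by [].
    rewrite tE; transitivity (restriction (@e n) (s n) (a, b)); first by [].
    by rewrite se.
  by apply/seteqP; split=> -[x y]; have [n [a [b [<- <-]]]] := rep2 x y;
    rewrite /restriction /= !phiE tiff.
exists S; split; first by split=> //; exact: phi_S.
move=> t [ct tr].
have tE n : restriction (@iota n) t = s n.
  apply/esym/su; first exact: (congr_preimage (iotah n) ct).
  by rewrite /rn -tr; apply/seteqP; split=> -[x y]; rewrite /restriction /= !phiE.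
have tSE n (a b : L n) : t (iota a, iota b) = S (iota a, iota b).
  transitivity (restriction (@iota n) t (a, b)); first by [].
  by rewrite tE -SE.
by apply/seteqP; split=> -[x y]; have [n [a [b [<- <-]]]] := lim_rep2 x y; rewrite tSE.
Qed.

(** Two elements identified by [phi] are identified by every congruence that
    extends to the limit, in particular by equality. *)
Let phi_inj : injective phi.
Proof.
move=> x y xy; have cd : congruence [set: K] [set p | p.1 = p.2].
  by split=> //= [u v w -> //|u1 v1 u2 v2 -> ->|u1 v1 u2 v2 -> ->].
have [s [[cs sd] _]] := phi_ext cd.
have : restriction phi s (x, y) by rewrite /restriction /= xy; exact: (congr_refl cs).
by rewrite sd.
Qed.

Let lim_omega : omega_congruence_finite Lim.
Proof.
exists (fun n => range (@iota n)); split=> [n|n|n _ [x _ <-]|].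
- move=> _ _ [x _ <-] [y _ <-]; rewrite -(iotah n).1 -(iotah n).2.
  by split; [exists (x `&` y)|exists (x `|` y)].
- apply: range_congruence_finite (iotah n) _.
  apply: ext_uniquely_finite (semb_hom (tower n)) (semb_ext (tower n)) _.
  exact: sub_congruence_finite.
- by exists (k x) => //; exact: inj_limS.
- apply/seteqP; split=> // z _; have [N /(_ N (leqnn N))[x xz]] := inj_lim_rep z.
  by exists N => //; exists x.
Qed.

(** Representatives of [a], [b] and [c] need not be increasing; replacing them by
    [x], [x `|` y] and [x `|` y `|` z] makes them so. *)
Let lim_complemented : relatively_complemented Lim.
Proof.
move=> a b c ab bc.
have [n [x [y [z [xa yb zc]]]]] : exists n (x y z : L n), [/\ iota x = a, iota y = b & iota z = c].
  have [N hN] := inj_lim_rep a; have [M hM] := inj_lim_rep b; have [R hR] := inj_lim_rep c.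
  pose n := maxn N (maxn M R).
  have [x xa] := hN n (leq_maxl _ _).
  have [y yb] := hM n (leq_trans (leq_maxl M R) (leq_maxr _ _)).
  have [z zc] := hR n (leq_trans (leq_maxr M R) (leq_maxr _ _)).
  by exists n, x, y, z.
have [_ _ compl] := knextP (tower n).
have [w [w1 w3]] := compl x (x `|` y) (x `|` y `|` z) (leUl _ _) (leUl _ _).
have xy : iota (x `|` y) = b by rewrite (iotah n).2 xa yb; exact/join_idPr.
have xyz : iota (x `|` y `|` z) = c by rewrite (iotah n).2 xy zc; exact/join_idPr.
have iotaS (v : L n) : iota (k v) = iota v by exact: inj_limS.
exists (@iota n.+1 w); rewrite -xy -iotaS -(iotah n.+1).1 -(iotah n.+1).2.
by rewrite w1 w3 !iotaS xa xyz.
Qed.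

Let phi_zero z : is_zero z -> is_zero (phi z).
Proof.
move=> zz w _; have [N /(_ N (leqnn N))[x <-]] := inj_lim_rep w.
have [y yz] := sub_exists (@sF N) (F_le (leq0n N) (F0 zz)).
have -> : phi z = iota (e y) by rewrite -phiE /val yz.
by apply: (lhom_le (iotah N)); apply: semb_zero; rewrite /val yz.
Qed.

Lemma tower_extension : exists (d' : Order.disp_t) (L : latticeType d')
    (f : {lmorphism K -> L}),
  [/\ congruence_preserving_extension f, omega_congruence_finite L,
      relatively_complemented L & forall z, is_zero z -> is_zero (f z)].
Proof.
have [f fE] := lmorphism_exists phi_hom.
exists cdisp, Lim, f; split=> //; last by rewrite fE.
by split; rewrite fE.
Qed.

End Tower.

Theorem theorem3 (d : Order.disp_t) (K : latticeType d)
    (hK : omega_congruence_finite K) :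
  (exists (d' : Order.disp_t) (L : latticeType d') (f : {lmorphism K -> L}),
     [/\ congruence_preserving_extension f,
         omega_congruence_finite L
       & relatively_complemented L]) /\
  (forall z : K, is_zero z ->
   exists (d' : Order.disp_t) (L : latticeType d') (f : {lmorphism K -> L}),
     [/\ congruence_preserving_extension f,
         omega_congruence_finite L,
         relatively_complemented L
       & is_zero (f z)]).
Proof.
have [F [sF finF FS Fcover]] := hK.
(* Dropping the first terms puts the zero of [K], if any, in all sublattices. *)
have [N FN] : exists N, forall z, is_zero z -> F N z.
  have [[z zz]|nz] := pselect (exists z : K, is_zero z); last first.
    by exists 0 => z zz; case: nz; exists z.
  have : [set: K] z by [].
  rewrite -Fcover => -[N _ FNz]; exists N => z' zz'.
  suff -> : z' = z by [].
  by apply/le_anti; rewrite zz' // zz.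
have F_le n : F n `<=` F (n + N)%N.
  by rewrite addnC; elim: N {FN} => // M IH; exact: subset_trans (FS _).
have cover : \bigcup_n F (n + N)%N = [set: K].
  apply/seteqP; split=> // x _; have : [set: K] x by [].
  by rewrite -Fcover => -[n _ Fnx]; exists n => //; exact: F_le.
have [d' [L [f [fp Lo Lc fz]]]] := tower_extension (F := fun n => F (n + N)%N)
  (fun n => sF _) (fun n => finF _) (fun n => FS _) cover FN.
split=> [|z zz]; exists d', L, f; split=> //.
exact: fz.
Qed.
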